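(* Let $f$ and $g$ be the identity (a student of ability $a$ in a job of quality $q$ contributes $aq$), and let the aggregate distribution of student abilities be uniform on $[0,1]$. Then the connected equilibrium $Q_{eq}$ of the strategic grading game satisfies $$\frac{\int_0^1 q\,Q_T^{-1}(q)\,d\mu(q)}{\int_0^1 q\,Q_{eq}^{-1}(q)\,d\mu(q)}\le 1.36,$$ i.e. the price of anarchy of the strategic grading game is at most $1.36$.
   Context: Students form a continuum of unit mass; aggregate true abilities uniform on $[0,1]$. Jobs form a continuum of unit mass with qualities in $[0,1]$ distributed with continuous CDF $\mu$ with positive density $\mu'$. The truthful mapping $Q_T$ is the nondecreasing assortative map (students with ability at most $a$ are exactly those assigned jobs of quality at most $Q_T(a)$); it is assumed to switch between convex and concave pieces only finitely many times. There are finitely many school types, each a continuum of infinitesimal schools with public ability distributions. A transcript structure of a school is a (possibly stochastic) map giving each student a label (''expected ability'') $\hat a\in[0,1]$ such that the average true ability of the school's students with label $\hat a$ equals $\hat a$. A profile of transcript structures yields an aggregate label distribution $G$; students are then assigned to jobs assortatively by label, and the desirability mapping $Q(\hat a)$ is the expected quality of the job given to a student with label $\hat a$. A profile is an equilibrium if for each school type $i$, with label distribution $G_i$, and every alternative transcript structure with label distribution $\hat G_i$, $\int_0^1 Q\,dG_i\ge\int_0^1 Q\,d\hat G_i$ with $Q$ held fixed. An equilibrium with lowest and highest labels $\hat a_L,\hat a_H$ is connected if every $\hat a\in(\hat a_L,\hat a_H)$ has a neighborhood all of whose labels are produced by some school. The connected equilibrium is unique (Ostrovsky–Schwarz) and its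 desirability mapping is denoted $Q_{eq}$; $Q_{eq}^{-1}(q)$ is the label of the student receiving job $q$. *)

(* Defs.v *)
From mathcomp Require Import all_boot all_order all_algebra.
From mathcomp Require Import all_classical all_reals all_analysis.
Import Order.TTheory GRing.Theory Num.Theory.
Set Implicit Arguments. Unset Strict Implicit. Unset Printing Implicit Defensive.
Local Open Scope classical_set_scope.
Local Open Scope ring_scope.

Section Grading.
Context {R : realType}.

Definition is_job_density (dens : R -> R) : Prop :=
  measurable_fun setT dens /\
  (forall q, 0 <= dens q) /\
  (forall q, 0 < q < 1 -> 0 < dens q) /\
  (forall q, (q < 0) \/ (1 < q) -> dens q = 0) /\
  (\int[@lebesgue_measure R]_(q in `[0%R, 1%R]) (dens q)%:E = 1)%E.

Definition job_cdf (dens : R -> R) (x : R) : R :=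
  \int[@lebesgue_measure R]_(t in `[0%R, x]) dens t.

Definition job_quantile (dens : R -> R) (t : R) : R :=
  inf [set q : R | 0 <= q /\ t <= job_cdf dens q].

(* Truthful mapping: with abilities uniform on [0,1], the students with
   ability <= a (mass a) are exactly those assigned jobs of quality <= Q_T(a),
   i.e. mu (Q_T a) = a, so Q_T = mu^{-1}. *)
Definition truthful_map (dens : R -> R) : R -> R := job_quantile dens.

(* Q_T^{-1}(q): the (true) ability of the student receiving job q under
   truthful assortative matching, i.e. mu(q). *)
Definition truthful_label (dens : R -> R) (q : R) : R := job_cdf dens q.

Definition convex_on (a b : R) (f : R -> R) : Prop :=
  forall x y t, a <= x <= b -> a <= y <= b -> 0 <= t <= 1 ->
    f (t * x + (1 - t) * y) <= t * f x + (1 - t) * f y.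

Definition concave_on (a b : R) (f : R -> R) : Prop :=
  forall x y t, a <= x <= b -> a <= y <= b -> 0 <= t <= 1 ->
    t * f x + (1 - t) * f y <= f (t * x + (1 - t) * y).

Definition finitely_many_switches (f : R -> R) : Prop :=
  exists (k : nat) (s : nat -> R),
    s 0%N = 0 /\ s k = 1 /\
    (forall j, (j < k)%N -> s j < s j.+1) /\
    (forall j, (j < k)%N -> convex_on (s j) (s j.+1) f \/
                            concave_on (s j) (s j.+1) f).

Definition school_types (n : nat) (w : 'I_n -> R)
    (F : 'I_n -> probability R R) : Prop :=
  (forall i, 0 < w i) /\ (\sum_(i < n) w i = 1) /\
  (forall A : set R, measurable A ->
     (\sum_(i < n) ((w i)%:E * F i A))%E
       = @lebesgue_measure R (A `&` `[0%R, 1%R])).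

(* A transcript structure of a school with ability distribution Fi: the joint
   law pi of (true ability, label) of its students. The first marginal is Fi,
   labels lie in [0,1], and the average true ability of the students with
   label in any measurable B equals the average label (i.e. E[a | label] =
   label). *)
Definition is_transcript (Fi : probability R R)
    (pi : probability (R * R)%type R) : Prop :=
  (forall A : set R, measurable A -> pi (A `*` setT) = Fi A) /\
  pi (setT `*` `[0%R, 1%R]) = 1%E /\
  (forall B : set R, measurable B ->
     (\int[pi]_(z in setT `*` B) (z.1)%:E
       = \int[pi]_(z in setT `*` B) (z.2)%:E)%E).

Definition agg_labels (n : nat) (w : 'I_n -> R)
    (pi : 'I_n -> probability (R * R)%type R) (B : set R) : \bar R :=
  (\sum_(i < n) ((w i)%:E * pi i (setT `*` B)))%E.

Definition label_cdf (n : nat) (w : 'I_n -> R) pi (x : R) : R :=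
  fine (@agg_labels n w pi `]-oo, x]).

Definition label_atom (n : nat) (w : 'I_n -> R) pi (x : R) : R :=
  fine (@agg_labels n w pi [set x]).

(* Desirability mapping Q: expected quality of the job of a student with
   label x, under assortative assignment by label (ties broken uniformly at
   random: an atom of G at x occupies the job quantiles [G(x-), G(x)]). *)
Definition desirability (dens : R -> R) (n : nat) (w : 'I_n -> R) pi (x : R) : R :=
  let m := label_atom w pi x in
  let c := label_cdf w pi x in
  if 0 < m then
    (\int[@lebesgue_measure R]_(t in `[(c - m)%R, c]) job_quantile dens t) / m
  else job_quantile dens c.

Definition is_equilibrium (dens : R -> R) (n : nat) (w : 'I_n -> R) (F : 'I_n -> probability R R)
    (pi : 'I_n -> probability (R * R)%type R) : Prop :=
  (forall i, is_transcript (F i) (pi i)) /\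
  (forall i (pi' : probability (R * R)%type R), is_transcript (F i) pi' ->
     (\int[pi']_z (desirability dens w pi z.2)%:E
       <= \int[pi i]_z (desirability dens w pi z.2)%:E)%E).

Definition produced_labels (n : nat) (w : 'I_n -> R) pi : set R :=
  [set x | forall e : R, 0 < e -> (0 < @agg_labels n w pi `](x - e)%R, (x + e)%R[)%E].

Definition is_connected (n : nat) (w : 'I_n -> R) pi : Prop :=
  let S := @produced_labels n w pi in
  forall x, inf S < x < sup S ->
    exists2 e : R, 0 < e & forall y, `|y - x| < e -> S y.

(* Q_eq^{-1}(q): label of the student receiving job q, i.e. the label at
   quantile mu(q) of the aggregate label distribution *)
Definition eq_label (dens : R -> R) (n : nat) (w : 'I_n -> R) pi (q : R) : R :=
  inf [set x : R | job_cdf dens q <= label_cdf w pi x].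

Definition total_output (dens : R -> R) (L : R -> R) : R :=
  \int[@lebesgue_measure R]_(q in `[0%R, 1%R]) (q * L q * dens q).

End Grading.

(* Main.v *)
Require Import Defs.
From HB Require Import structures.
From mathcomp Require Import all_boot all_order all_algebra.
From mathcomp Require Import all_classical all_reals all_analysis.
From mathcomp Require Import measurable_realfun ring lra.
Import Order.TTheory GRing.Theory Num.Theory.
Import numFieldNormedType.Exports.
Local Open Scope ring_scope.

(** Let [x t] and [Q t] be the equilibrium label and the job quality at rank
    [t]: both are nondecreasing on [0, 1], the truthful output is [\int t * Q t]
    and the equilibrium output is [\int x t * Q t].

    One family of deviations suffices. Among its students with label at most
    [y], a school gives label [y] to those of ability above [y] together with
    just enough of the others for the average to be [y], and reveals the rest.
    If the label law had an atom, labels slightly above it would be strictly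
    better at almost no cost, so there is none. Applied to [y = x s], the
    deviation gives
      [Q s * ((1 - x s ^+ 2) / 2 - \int_s^1 x) <= x s * \int_0^s Q].
    Multiplying by [k / x s] and integrating over [s] in [3/5, 1] yields
    [\int Q * phi <= 136/100 * \int x * Q - \int t * Q], where [phi] depends on
    [x] only. As [Q] is nondecreasing, it is enough that every tail integral of
    [phi] is nonnegative. On [3/5, 1] a tail of [phi] is bounded below in terms
    of the mean of [x] on it, and what remains is a rational inequality; [k] is
    9/20, 9/25 or 0 according to the mean of [x] on [3/5, 1]. *)

Set Implicit Arguments. Unset Strict Implicit. Unset Printing Implicit Defensive.

(** * Integrals of locally bounded functions over intervals *)

Section LocallyBounded.
Local Open Scope classical_set_scope.
Local Open Scope ring_scope.
Context {R : realType}.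
Notation mu := (@lebesgue_measure R).
Implicit Types (f g : R -> R) (a b c t s : R).

(** Where the pooling inequality comes from: students of ability above [y = x s] who are labelled at
    most [y] carry at least the total ability above [y] minus the total ability labelled above [y],
    and calibration turns the latter into [\int_s^1 x]. A pool of average [y] containing them has
    mass at least that amount divided by [y]; each member receives [Q s], while the labels up to [y]
    used to share [\int_0^s Q]. The result is nonlinear in [x] but linear in [Q], so the unknown job
    distribution can be eliminated, leaving conditions on [x] alone. The division by [x s] is
    harmful for small labels. Starting at [3/5] keeps every label involved above the mean [a] of [x]
    on [0, 3/5], and the overall mean 1/2 forces [a >= 1/6]. Why [k] varies: with nearly constant
    labels [136/100 * eta - 1] is negative and the gain [k / 2 * (1 / eta - eta)] must compensate.
    As the upper mean grows, [a] falls and the cost [k * (1 - T)] on the ranks below [T = 3/5]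
    becomes too heavy; beyond [25/34], the inverse of [136/100], no gain is required. *)

Definition locally_bounded_mfun f : Prop :=
  measurable_fun setT f /\
  forall a b, exists M, forall t, a <= t <= b -> `|f t| <= M.

Notation lbm := locally_bounded_mfun.

Definition itvint a b f : R := \int[mu]_(t in `[a, b]) f t.

Lemma lbm_integrable f a b : lbm f -> mu.-integrable `[a, b] (EFin \o f).
Proof.
move=> [mf bf]; apply: measurable_bounded_integrable => //.
- by rewrite /= lebesgue_measure_itv/=; case: ifP => _ //; rewrite -EFinD ltry.
- exact: measurable_funTS.
have [M HM] := bf a b; exists M; split; first by rewrite num_real.
move=> N MN t /=; rewrite in_itv /= => tab; exact: le_trans (HM _ tab) (ltW MN).
Qed.

Lemma lbm_cst c : lbm (fun=> c).
Proof. by split => // a b; exists `|c|. Qed.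

Lemma lbm_id : lbm (fun t => t).
Proof.
split => // a b; exists (`|a| + `|b|) => t /andP[at_ tb].
rewrite ler_norml; apply/andP; split.
  have := ler_norm (- a); rewrite normrN; have := normr_ge0 b; lra.
have := ler_norm b; have := normr_ge0 a; lra.
Qed.

Lemma lbmD f g : lbm f -> lbm g -> lbm (fun t => f t + g t).
Proof.
move=> [mf bf] [mg bg]; split; first exact: measurable_funD.
move=> a b; have [M HM] := bf a b; have [N HN] := bg a b.
by exists (M + N) => t tab; rewrite (le_trans (ler_normD _ _))// lerD ?HM ?HN.
Qed.

Lemma lbmM f g : lbm f -> lbm g -> lbm (fun t => f t * g t).
Proof.
move=> [mf bf] [mg bg]; split; first exact: measurable_funM.
move=> a b; have [M HM] := bf a b; have [N HN] := bg a b.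
by exists (M * N) => t tab; rewrite normrM ler_pM ?HM ?HN.
Qed.

Lemma lbmX n f : lbm f -> lbm (fun t => f t ^+ n).
Proof.
move=> lf; elim: n => [|n IHn]; first exact: lbm_cst.
by have := lbmM lf IHn; under eq_fun do rewrite -exprS.
Qed.

Lemma lbmN f : lbm f -> lbm (fun t => - f t).
Proof.
move=> lf; have -> : (fun t => - f t) = (fun t => (-1) * f t).
  by apply/funext => t; rewrite mulN1r.
by apply: lbmM => //; exact: lbm_cst.
Qed.

Lemma lbmB f g : lbm f -> lbm g -> lbm (fun t => f t - g t).
Proof. by move=> lf lg; apply: lbmD => //; exact: lbmN. Qed.

Lemma lbm_nondecreasing f : nondecreasing_fun f -> lbm f.
Proof.
move=> ndf; split; first exact: nondecreasing_measurable.
move=> a b; exists (`|f a| + `|f b|) => t /andP[/ndf fa /ndf fb].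
rewrite ler_norml; apply/andP; split.
  have := ler_norm (- f a); rewrite normrN; have := normr_ge0 (f b); lra.
have := ler_norm (f b); have := normr_ge0 (f a); lra.
Qed.

Lemma lbm_nonincreasing f : nonincreasing_fun f -> lbm f.
Proof.
move=> nif; have -> : f = (fun t => - - f t) by apply/funext => t; rewrite opprK.
by apply: lbmN; apply: lbm_nondecreasing => s t st; rewrite lerN2 nif.
Qed.

End LocallyBounded.
Notation lbm := locally_bounded_mfun.

(** Closure under ring operations, together with the monotone case, makes the integrability side
    conditions syntactic. *)
Ltac lbm_tac := repeat first [ assumption | exact: lbm_cst | exact: lbm_id
  | apply: lbmB | apply: lbmD | apply: lbmN | apply: lbmM
  | apply: lbmX ].

Section IntervalIntegral.
Local Open Scope classical_set_scope.
Local Open Scope ring_scope.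
Context {R : realType}.
Notation mu := (@lebesgue_measure R).
Implicit Types (f g : R -> R) (a b c t s : R).

Lemma itvintD a b f g : lbm f -> lbm g ->
  itvint a b (fun t => f t + g t) = itvint a b f + itvint a b g.
Proof. by move=> lf lg; rewrite /itvint RintegralD//; exact: lbm_integrable. Qed.

Lemma itvintB a b f g : lbm f -> lbm g ->
  itvint a b (fun t => f t - g t) = itvint a b f - itvint a b g.
Proof. by move=> lf lg; rewrite /itvint RintegralB//; exact: lbm_integrable. Qed.

Lemma itvintZ a b c f : lbm f -> itvint a b (fun t => c * f t) = c * itvint a b f.
Proof. by move=> lf; rewrite /itvint RintegralZl//; exact: lbm_integrable. Qed.

Lemma itvint_cst a b c : a <= b -> itvint a b (fun=> c) = c * (b - a).
Proof.
move=> ab; rewrite /itvint Rintegral_cst//= lebesgue_measure_itv/= lte_fin.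
case: ltP => // ba; have -> : a = b by lra.
by rewrite subrr.
Qed.

Lemma itvint_split a b c f : lbm f -> a <= c -> c <= b ->
  itvint a b f = itvint a c f + itvint c b f.
Proof.
move=> lf ac cb; have H := @Rintegral_itvB R f (BLeft a) (BRight b) c.
have := H (lbm_integrable a b lf); rewrite !bnd_simp ac cb => /(_ isT isT).
rewrite Rintegral_itv_obnd_cbnd; first by move=> E; rewrite /itvint -E; ring.
by apply: integrableS (lbm_integrable c b lf) => //; apply: subset_itvr; rewrite bnd_simp.
Qed.

(** Endpoints are null, so the comparison is required only inside; the integrands used later switch
    formula at endpoints such as [T]. *)
Lemma itvint_le a b f g : lbm f -> lbm g ->
  (forall t, a < t < b -> f t <= g t) -> itvint a b f <= itvint a b g.
Proof.
move=> lf lg fg; rewrite /itvint.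
have sub : `]a, b[ `<=` `[a, b] by exact: subset_itvW.
have sub' : `[a, b[ `<=` `[a, b] by apply: subset_itvl; rewrite bnd_simp.
have io f' : lbm f' -> \int[mu]_(t in `[a, b]) f' t = \int[mu]_(t in `]a, b[) f' t.
  move=> lf'; have i := lbm_integrable a b lf'.
  rewrite -Rintegral_itv_bndo_bndc; last apply: integrableS i => //.
  by rewrite -Rintegral_itv_obnd_cbnd//; apply: integrableS i => //.
rewrite !io//; apply: le_Rintegral => //.
- exact: integrableS (lbm_integrable a b lf).
- exact: integrableS (lbm_integrable a b lg).
Qed.

Lemma itvint_ge0 a b f : (forall t, a <= t <= b -> 0 <= f t) -> 0 <= itvint a b f.
Proof. by move=> f0; apply: Rintegral_ge0 => t /=; rewrite in_itv; exact: f0. Qed.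

Lemma eq_itvint a b f g : (forall t, a <= t <= b -> f t = g t) -> itvint a b f = itvint a b g.
Proof. by move=> fg; apply: eq_Rintegral => t; rewrite inE /= in_itv; exact: fg. Qed.

Lemma itvint_gt a b f : b < a -> itvint a b f = 0.
Proof.
by move=> ba; rewrite /itvint set_itv_ge ?Rintegral_set0// bnd_simp -ltNge.
Qed.

Lemma itvint_tail_nonincreasing b f : lbm f -> (forall t, 0 <= f t) ->
  nonincreasing_fun (fun t => itvint t b f).
Proof.
move=> lf f0 s t st; case: (leP t b) => tb; last first.
  by rewrite (itvint_gt _ tb); exact: Rintegral_ge0.
rewrite (itvint_split lf st tb) lerDr; exact: itvint_ge0.
Qed.

Lemma itvint_head_nondecreasing a f : lbm f -> (forall t, 0 <= f t) ->
  nondecreasing_fun (fun t => itvint a t f).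
Proof.
move=> lf f0 s t st; case: (leP a s) => tb; last first.
  by rewrite (itvint_gt _ tb); exact: Rintegral_ge0.
rewrite (itvint_split lf tb st) lerDl; exact: itvint_ge0.
Qed.

(** Both sides integrate [f r] over the triangle [a <= t <= r <= b]; [g] extends that integrand by
    zero to the plane. *)
Lemma itvint_tonelli a b f : a <= b -> lbm f -> (forall t, 0 <= f t) ->
  itvint a b (fun t => itvint t b f) = itvint a b (fun r => (r - a) * f r).
Proof.
move=> ab lf f0; have [mf _] := lf.
pose g (z : R * R) : \bar R :=
  (\1_(`[a, b]) z.1 * (\1_(`[a, b]) z.2 * ((z.1 <= z.2)%R%:R * f z.2)))%:E.
have g0 z : (0 <= g z)%E by rewrite lee_fin !mulr_ge0.
have mle : measurable_fun setT (fun z : R * R => (z.1 <= z.2)%R).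
  by apply: measurable_fun_ler; [exact: measurable_fst | exact: measurable_snd].
have mg : measurable_fun setT g.
  apply/measurable_EFinP.
  apply: measurable_funM.
    by apply: measurableT_comp; [exact: measurable_indic | exact: measurable_fst].
  apply: measurable_funM.
    by apply: measurableT_comp; [exact: measurable_indic | exact: measurable_snd].
  apply: measurable_funM; last by apply: measurableT_comp => //; exact: measurable_snd.
  have -> : (fun z : R * R => (z.1 <= z.2)%R%:R : R) =
            (fun z => if (z.1 <= z.2)%R then 1 else 0).
    by apply/funext => z; case: ifP.
  by apply: measurable_fun_ifT.
rewrite /itvint.
have E1 : (\int[mu]_x \int[mu]_y g (x, y) =
           \int[mu]_(x in `[a, b]) (itvint x b f)%:E)%E.
  rewrite [RHS]integral_mkcond; apply: eq_integral => x _.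
  rewrite /patch; case: ifPn => xab; last first.
    rewrite integral0_eq// => y _; rewrite /g /=.
    by rewrite indicE (negbTE xab) mul0r.
  rewrite /itvint /Rintegral fineK; last first.
    by apply: integrable_fin_num => //; exact: lbm_integrable.
  rewrite [RHS]integral_mkcond; apply: eq_integral => y _.
  rewrite /patch /g /= indicE xab mul1r; move: xab; rewrite inE /= in_itv /= => /andP[ax xb].
  case: ifPn; rewrite ?inE ?notin_setE /= in_itv /=.
    by move=> /andP[xy yb]; rewrite indicE mem_set ?xy ?mul1r//= in_itv /= yb (le_trans ax).
  move=> /negP; rewrite negb_and; rewrite indicE.
  case: (boolP (x <= y)) => //= xy yb; last by rewrite mul0r mulr0.
  by rewrite memNset ?mul0r//= in_itv /= (negbTE yb) andbF.
have E2 : (\int[mu]_y \int[mu]_x g (x, y) =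
           \int[mu]_(y in `[a, b]) ((y - a) * f y)%:E)%E.
  rewrite [RHS]integral_mkcond; apply: eq_integral => y _.
  rewrite /patch; case: ifPn => yab; last first.
    rewrite integral0_eq// => x _; rewrite /g /=.
    by rewrite [X in (_ * (X * _))%R]indicE (negbTE yab) mul0r mulr0.
  transitivity (\int[mu]_(x in `[a, y]) (f y)%:E)%E.
    rewrite [RHS]integral_mkcond; apply: eq_integral => x _.
    rewrite /patch /g /= [X in (_ * (X * _))%R]indicE yab mul1r.
    move: yab; rewrite inE /= in_itv /= => /andP[ay yb].
    case: ifPn; rewrite ?inE ?notin_setE /= in_itv /=.
      by move=> /andP[ax xy]; rewrite indicE mem_set ?xy ?mul1r//= in_itv /= ax (le_trans xy).
    move=> /negP; rewrite negb_and indicE.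
    case: (boolP (x <= y)) => //= xy; last by rewrite mul0r mulr0.
    rewrite orbF => ax.
    by rewrite memNset ?mul0r//= in_itv /= (negbTE ax).
  move: yab; rewrite inE /= in_itv /= => /andP[ay yb].
  rewrite integral_cst//= lebesgue_measure_itv /= lte_fin.
  case: ltP => ya; first by rewrite -EFinD -EFinM mulrC.
  have -> : y = a by lra.
  by rewrite mule0 subrr mul0r.
by rewrite /Rintegral; congr fine; rewrite -E1 -E2; exact: fubini_tonelli.
Qed.

(** Tonelli for the constant 1 gives [\int (b - t) = \int (t - a)], a linear equation for the
    integral sought. *)
Lemma itvint_id a b : a <= b -> itvint a b (fun t => t) = (b ^+ 2 - a ^+ 2) / 2.
Proof.
move=> ab; have := itvint_tonelli ab (lbm_cst 1) (fun=> ler01).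
rewrite (@eq_itvint a b _ (fun t => b - t)); last first.
  by move=> t /andP[_ tb]; rewrite (itvint_cst _ tb) mul1r.
rewrite [RHS](@eq_itvint a b _ (fun t => t - a)); last by move=> t _; rewrite mulr1.
rewrite !itvintB ?itvint_cst//; try by lbm_tac.
move: (itvint a b _) => S E; have -> : S = (b * (b-a) + a * (b - a)) / 2 by lra.
by ring.
Qed.

Lemma itvint_sqr a b : 0 <= a -> a <= b ->
  itvint a b (fun t => t ^+ 2) = (b ^+ 3 - a ^+ 3) / 3.
Proof.
(* Tonelli is applied to the identity; its positive part [p] supplies nonnegativity on the whole
   line. *)
move=> a0 ab; pose p t := Num.max 0 t.
have lp : lbm p by apply: lbm_nondecreasing => s t st; rewrite /p le_max2.
have p0 t : 0 <= p t by rewrite le_max lexx.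
have pE t : 0 <= t -> p t = t by move=> t0; apply/max_idPr.
have := itvint_tonelli ab lp p0.
rewrite (@eq_itvint a b _ (fun t => (b ^+ 2) / 2 - 2^-1 * (t * t))); last first.
  move=> t /andP[at_ tb].
  rewrite (@eq_itvint _ _ _ (fun t => t)); last first.
    by move=> u /andP[tu _]; rewrite pE// (le_trans a0)// (le_trans at_).
  by rewrite itvint_id//; lra.
rewrite [RHS](@eq_itvint a b _ (fun t => t * t - a * t)); last first.
  by move=> t /andP[at_ _]; rewrite pE ?(le_trans a0)//; ring.
have l2 : lbm (fun t : R => t * t) by apply: lbmM; exact: lbm_id.
rewrite !itvintB ?itvintZ ?itvint_cst ?itvint_id//; try by lbm_tac.
rewrite (@eq_itvint _ _ (fun t => t ^+ 2) (fun t => t * t)); last by move=> t _; rewrite expr2.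
move: (itvint a b _) => S E.
have -> : S = (2 / 3) * (b ^+ 2 / 2 * (b - a) + a * ((b ^+ 2 - a ^+ 2) / 2)) by lra.
by field.
Qed.

End IntervalIntegral.

(** * Monotone weights and nonnegative tails *)

Section Layers.
Local Open Scope classical_set_scope.
Local Open Scope ring_scope.
Context {R : realType}.
Implicit Types (f phi : R -> R) (Q : R -> R).

Lemma lbm_upset (P : R -> bool) : (forall s t, s <= t -> P s -> P t) ->
  lbm (fun t => (P t)%:R : R).
Proof.
move=> upP; apply: lbm_nondecreasing => s t st.
by case: (boolP (P s)) => [/(upP _ _ st) ->//|_]; rewrite ler0n.
Qed.

(** Up to one endpoint, an upper set meets [0, 1] in a tail starting at its infimum. *)
Lemma itvint_upset_ge0 (P : R -> bool) phi : (forall s t, s <= t -> P s -> P t) ->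
  lbm phi -> (forall s, 0 <= s <= 1 -> 0 <= itvint s 1 phi) ->
  0 <= itvint 0 1 (fun t => (P t)%:R * phi t).
Proof.
move=> upP lphi tail.
have lP := lbm_upset upP.
have lPp : lbm (fun t => (P t)%:R * phi t) by apply: lbmM.
(* Adding the point 1 keeps [E] nonempty when [P] fails on all of [0, 1]. *)
pose E := [set t : R | 0 <= t <= 1 /\ (P t \/ t = 1)].
have E1 : E 1 by split; [rewrite ler01 lexx | right].
have hE : has_inf E.
  by split; [exists 1 | exists 0 => t [/andP[]]].
set s := inf E.
have s0 : 0 <= s by apply: lb_le_inf; [exists 1 | move=> t [/andP[]]].
have s1 : s <= 1 by apply: ge_inf => //; case: hE.
rewrite (itvint_split lPp s0 s1) addr_ge0//.
  rewrite [leLHS](_ : 0 = itvint 0 s (fun=> 0)); last by rewrite itvint_cst// mul0r.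
  apply: itvint_le => //; first exact: lbm_cst.
  move=> t /andP[t0 ts]; case: (boolP (P t)) => [Pt|_]; last by rewrite mul0r.
  have : s <= t.
    apply: ge_inf; first by case: hE.
    by split; [rewrite (ltW t0) (le_trans (ltW ts)) | left].
  lra.
apply: le_trans (tail s _) _; first by rewrite s0.
apply: itvint_le => // t /andP[st t1].
have [u [_ Eu] ut] := inf_lt hE.1 st.
by case: Eu => [Pu|]; [rewrite (upP _ _ (ltW ut) Pu) mul1r|lra].
Qed.

(** The sum is the integer part of [y]. *)
Lemma sum_thresholds n (y : R) : 0 <= y <= n%:R ->
  y - 1 <= \sum_(k < n) (k.+1%:R <= y)%R%:R <= y.
Proof.
elim: n y => [|n IHn] y /andP[y0 yn].
  by rewrite big_ord0; apply/andP; split; lra.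
rewrite big_ord_recr /=; case: (leP y n%:R) => ny.
  have -> : (n.+1%:R <= y) = false.
    by apply/negbTE; rewrite -ltNge (le_lt_trans ny)// ltr_nat.
  by rewrite addr0; apply: IHn; rewrite y0.
rewrite (eq_bigr (fun=> 1)); last first.
  move=> k _; rewrite [X in nat_of_bool X](_ : _ = true)//.
  by apply: le_trans (ltW ny); rewrite ler_nat.
rewrite sumr_const card_ord -natr1 in yn *.
case: (leP (n%:R + 1) y) => [nn|yy]; rewrite ?mulr1n ?mulr0n; apply/andP; split; lra.
Qed.

(* [n * Q t] exceeds the number of [k < n] with [k + 1 <= n * Q t] by at most 1,
   and each of the corresponding upper sets has a nonnegative integral; divide
   by [n]. *)
Lemma nondecreasing_tail_ge0 Q phi : nondecreasing_fun Q ->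
  (forall t, 0 <= Q t <= 1) -> lbm phi ->
  (forall s, 0 <= s <= 1 -> 0 <= itvint s 1 phi) ->
  0 <= itvint 0 1 (fun t => Q t * phi t).
Proof.
move=> ndQ Q01 lphi tail.
have lQ := lbm_nondecreasing ndQ.
have [M HM] := lphi.2 0 1.
have M0 : 0 <= M by apply: le_trans (HM 0 _); rewrite ?normr_ge0 ?lexx ?ler01.
(* The scale [n] stays fixed while the induction runs over the number [m] of layers. *)
pose S' n m t : R := \sum_(k < m) (k.+1%:R <= n%:R * Q t)%R%:R.
have SS n m : lbm (S' n m) /\ 0 <= itvint 0 1 (fun t => S' n m t * phi t).
  elim: m => [|m [IH1 IH2]].
    have E : S' n 0%N = fun=> 0 by apply/funext => t; rewrite /S' big_ord0.
    rewrite E; split; first exact: lbm_cst.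
    by rewrite (@eq_itvint _ _ _ _ (fun=> 0)) ?itvint_cst ?mul0r// => t _; rewrite mul0r.
  pose P t := m.+1%:R <= n%:R * Q t.
  have E : S' n m.+1 = fun t => S' n m t + (P t)%:R.
    by apply/funext => t; rewrite /S' big_ord_recr.
  have upP s t : s <= t -> P s -> P t.
    by move=> st /le_trans; apply; apply: ler_wpM2l => //; exact: ndQ.
  have lP := lbm_upset upP.
  rewrite E; split; first exact: lbmD.
  rewrite (@eq_itvint _ _ _ _ (fun t => S' n m t * phi t + (P t)%:R * phi t)); last first.
    by move=> t _; rewrite mulrDl.
  rewrite itvintD; [|exact: lbmM|exact: lbmM].
  by rewrite addr_ge0//; exact: itvint_upset_ge0.
have key n : - M <= n%:R * itvint 0 1 (fun t => Q t * phi t).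
  have [lS S0] := SS n n.
  rewrite -itvintZ; last exact: lbmM.
  have : itvint 0 1 (fun=> - M) + itvint 0 1 (fun t => S' n n t * phi t) <=
         itvint 0 1 (fun t => n%:R * (Q t * phi t)).
    rewrite -itvintD; [|exact: lbm_cst|exact: lbmM].
    apply: itvint_le.
    - by apply: lbmD; [exact: lbm_cst|exact: lbmM].
    - by apply: lbmM; [exact: lbm_cst|exact: lbmM].
    move=> t /andP[t0 t1].
    have /andP[Q0 Q1] := Q01 t.
    have /sum_thresholds : 0 <= n%:R * Q t <= n%:R.
      by rewrite mulr_ge0//= ler_piMr.
    rewrite -/(S' n n t) => /andP[h1 h2].
    have : `|phi t| <= M by apply: HM; rewrite !ltW.
    rewrite ler_norml => /andP[h3 h4].
    nra.
  rewrite itvint_cst// subr0 mulr1; lra.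
rewrite leNgt; apply/negP => neg.
set I := itvint _ _ _ in key neg.
have [n Hn] : exists n : nat, M / - I < n%:R.
  exists (Num.truncn (M / - I)).+1; exact: truncnS_gt.
have := key n; rewrite ltr_pdivrMr in Hn; lra.
Qed.

End Layers.

(** * The inequality between ranks, labels and job qualities *)

Section Ranks.
Local Open Scope classical_set_scope.
Local Open Scope ring_scope.
Context {R : realType}.

(** The value [f s] separates the two pieces; the comparison of means is cross-multiplied so that
    zero lengths need no special case. *)
Lemma itvint_mean_nondecreasing (f : R -> R) u s v : nondecreasing_fun f ->
  u <= s -> s <= v -> (v - s) * itvint u v f <= (v - u) * itvint s v f.
Proof.
move=> ndf us sv; have lf := lbm_nondecreasing ndf.
rewrite (itvint_split lf us sv).
have h1 : itvint u s f <= f s * (s - u).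
  rewrite -itvint_cst//; apply: itvint_le => //; first exact: lbm_cst.
  by move=> t /andP[_ ts]; apply: ndf; exact: ltW.
have h2 : f s * (v - s) <= itvint s v f.
  rewrite -itvint_cst//; apply: itvint_le => //; first exact: lbm_cst.
  by move=> t /andP[st _]; apply: ndf; exact: ltW.
nra.
Qed.

(* Used with [r = 1 / x], [b = 1 / a] and [eta = 1 / e] the mean of [x] on
   [s, 1]. Since [x <= 1], [1 / x] is at least its tangent at [eta] plus
   [(x * e - 1) ^+ 2], and this square is bounded below by a function affine in
   [x] through [0 <= (x * e - 1 - eta * b * (2 * t - 1 - s)) ^+ 2]. *)
Lemma tail_pointwise (k b e eta x r Xh t s c : R) :
  0 <= k -> 0 <= b -> eta * e = 1 -> r * x = 1 -> 1 <= r -> r <= b ->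
  (1 - t) * x <= Xh ->
  (c - k * e ^+ 2 / 2 - k / 2) * x + (- 1 + 2 * k - 2 * k * b * eta
     + 2 * k * (eta * b) ^+ 2 * (1 + s)) * t
   + (k * e - 2 * k + k * b * eta * (1 + s) - k / 2 * (eta * b) ^+ 2 * (1 + s) ^+ 2)
   + k * b * (x * (t - s)) - k * b * Xh - 2 * k * (eta * b) ^+ 2 * t ^+ 2
  <= c * x - t + k * (((1 - x ^+ 2) / 2 - Xh) * r) - k * (1 - t).
Proof.
move=> k0 b0 etae rx r1 rb hX.
(* [Xh * r] equals [1 - t] plus [r] times the excess of [Xh] over [(1 - t) * x]. The excess is
   nonnegative, and only it is charged at the crude rate [b]. *)
have rXh : Xh * r <= (1 - t) + (Xh - (1 - t) * x) * b.
  have -> : Xh * r = (1 - t) + (Xh - (1 - t) * x) * r.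
    by rewrite mulrBl -mulrA [x * r]mulrC rx; ring.
  by rewrite lerD2l ler_wpM2l// subr_ge0.
have rT : (2 * e - x * e ^+ 2) + (x * e - 1) ^+ 2 <= r.
  have -> : r = (2 * e - x * e ^+ 2) + r * (x * e - 1) ^+ 2.
    have -> : r * (x * e - 1) ^+ 2 = (r * x) * x * e ^+ 2 - 2 * (r * x) * e + r by ring.
    by rewrite rx; ring.
  by rewrite lerD2l -{1}[(_ - 1) ^+ 2]mul1r ler_wpM2r// sqr_ge0.
have sq : 0 <= ((x * e - 1) - eta * b * (2 * t - 1 - s)) ^+ 2 by exact: sqr_ge0.
have sqE : ((x * e - 1) - eta * b * (2 * t - 1 - s)) ^+ 2 =
   (x * e - 1) ^+ 2 - 2 * (x - eta) * b * (2 * t - 1 - s)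
     + (eta * b) ^+ 2 * (2 * t - 1 - s) ^+ 2.
  have H : (x - eta) * b = (x * e - 1) * (eta * b).
    have -> : (x * e - 1) * (eta * b) = (eta * e) * x * b - eta * b by ring.
    by rewrite etae; ring.
  by rewrite -[2 * (x - eta) * b]mulrA H; ring.
have -> : ((1 - x ^+ 2) / 2 - Xh) * r = r / 2 - x / 2 - Xh * r.
  have -> : ((1 - x ^+ 2) / 2 - Xh) * r = r / 2 - (r * x) * x / 2 - Xh * r by ring.
  by rewrite rx; ring.
rewrite sqE in sq; clear sqE.
have : (2 * e - x * e ^+ 2 + (2 * (x - eta) * b * (2 * t - 1 - s)
     - (eta * b) ^+ 2 * (2 * t - 1 - s) ^+ 2)) / 2 - x / 2
     - ((1 - t) + (Xh - (1 - t) * x) * b) <= r / 2 - x / 2 - Xh * r by lra.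
move=> /(ler_wpM2l k0); lra.
Qed.

Variables (x Q : R -> R).
Hypotheses (ndx : nondecreasing_fun x) (x01 : forall t, 0 <= x t <= 1).
Let lx : lbm x := lbm_nondecreasing ndx.
Let Xh t := itvint t 1 x.
Let lXh : lbm Xh.
Proof.
apply: lbm_nonincreasing; apply: itvint_tail_nonincreasing => // t.
by case/andP: (x01 t).
Qed.

Variables (a : R).
Hypothesis a0 : 0 < a.
(** Truncation at [a] keeps the inverse label bounded and monotone on the whole line; from rank [T]
    on it is exactly [1 / x]. *)
Let r t := (Num.max (x t) a)^-1.
Let lr : lbm r.
Proof.
apply: lbm_nonincreasing => s t st; rewrite /r lef_pV2 ?posrE ?lt_max ?a0 ?orbT//.
by rewrite le_max2 ?ndx.
Qed.
(** Total ability above [x t], minus total label beyond rank [t]: a lower bound for the ability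
    above [x t] that is labelled at most [x t]. *)
Let M t := (1 - x t ^+ 2) / 2 - Xh t.
Let lM : lbm M.
Proof. by rewrite /M; lbm_tac. Qed.

(** After integration the terms in [x * (t - s)] and [Xh] cancel by Tonelli ([W]), so the bound sees
    [x] only through its mean [eta]. *)
Lemma tail_integral_ge (c k s eta : R) : 0 <= k -> 0 <= s -> s <= 1 -> a <= x s -> 0 < eta ->
  itvint s 1 x = eta * (1 - s) ->
  (1 - s) * ((c - k / 2) * eta + k / 2 / eta - 1 + (2^-1 - k) * (1 - s)
     - k / 6 * (eta / a) ^+ 2 * (1 - s) ^+ 2)
  <= itvint s 1 (fun t => c * x t - t + k * (M t * r t) - k * (1 - t)).
Proof.
move=> k0 s0 s1 axs eta0 mean.
pose b := a^-1; pose e := eta^-1.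
have W := itvint_tonelli s1 lx (fun t => proj1 (andP (x01 t))).
pose c1 := c - k * e ^+ 2 / 2 - k / 2.
pose c2 := - 1 + 2 * k - 2 * k * b * eta + 2 * k * (eta * b) ^+ 2 * (1 + s).
have [c0 c0E] : exists z, z = k * e - 2 * k + k * b * eta * (1 + s)
    - k / 2 * (eta * b) ^+ 2 * (1 + s) ^+ 2 by eexists.
have ll : lbm (fun t => c1 * x t + c2 * t + c0 + k * b * ((t - s) * x t)
    - k * b * Xh t - 2 * k * (eta * b) ^+ 2 * t ^+ 2).
  by lbm_tac.
apply: le_trans (itvint_le ll _ _); last 2 first.
- lbm_tac.
- move=> t /andP[st t1].
  have axt : a <= x t by apply: le_trans axs _; apply: ndx; exact: ltW.
  have x0 : 0 < x t by exact: lt_le_trans axt.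
  have rE : r t = (x t)^-1 by rewrite /r (max_idPl axt).
  have /andP[_ x1] := x01 t.
  have := @tail_pointwise k b e eta (x t) (r t) (Xh t) t s c k0.
  rewrite -/c1 -/c2 -c0E /M => H; apply: le_trans (H _ _ _ _ _ _).
  + by rewrite [(t - s) * _]mulrC.
  + by rewrite /b invr_ge0 ltW.
  + by rewrite /e mulfV// gt_eqF.
  + by rewrite rE mulVf// gt_eqF.
  + by rewrite rE invf_ge1.
  + by rewrite rE /b lef_pV2 ?posrE.
  + rewrite /Xh mulrC -itvint_cst; last exact: ltW.
    apply: itvint_le => //; first exact: lbm_cst.
    by move=> u /andP[tu _]; apply: ndx; exact: ltW.
rewrite !itvintB ?itvintD ?itvintZ; try by lbm_tac.
rewrite -W -/Xh itvint_cst// itvint_id// itvint_sqr// mean.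
rewrite le_eqVlt; apply/orP; left; apply/eqP.
rewrite c0E /c1 /c2 /b /e; field.
by rewrite !gt_eqF.
Qed.


Hypotheses (ndQ : nondecreasing_fun Q) (Q01 : forall t, 0 <= Q t <= 1).
Let lQ : lbm Q := lbm_nondecreasing ndQ.
Variables (c k T xi : R).
Hypotheses (c0 : 0 <= c) (k0 : 0 <= k) (T0 : 0 < T) (T1 : T < 1).
Hypothesis C1 : forall s, 0 < s < 1 ->
  Q s * ((1 - x s ^+ 2) / 2 - itvint s 1 x) <= x s * itvint 0 s Q.
Hypotheses (aE : T * a = itvint 0 T x) (xiE : (1 - T) * xi = itvint T 1 x).
(** [N1] handles tails starting after [T], whose mean [eta] is at least [xi] by monotonicity. [N2]
    adds to the tail from [T] the piece between [s] and [T], where the mean of [x] is only known to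
    be at least [a]. *)
Hypothesis N1 : forall s eta, T <= s <= 1 -> xi <= eta <= 1 ->
  0 <= (c - k / 2) * eta + k / 2 / eta - 1 + (2^-1 - k) * (1 - s)
     - k / 6 * (eta / a) ^+ 2 * (1 - s) ^+ 2.
Hypothesis N2 : forall s, 0 <= s <= T ->
  0 <= (1 - T) * ((c - k / 2) * xi + k / 2 / xi - 1 + (2^-1 - k) * (1 - T)
     - k / 6 * (xi / a) ^+ 2 * (1 - T) ^+ 2)
   + (T - s) * (c * a - k * (1 - T) - (T + s) / 2).

Let x_ge s : T <= s -> a <= x s.
Proof.
move=> Ts; apply: le_trans (ndx Ts); rewrite -(ler_pM2l T0) aE.
have -> : T * x T = x T * (T - 0) by ring.
rewrite -itvint_cst; last exact: ltW.
by apply: itvint_le => //; [exact: lbm_cst|move=> t /andP[_ /ltW /ndx]].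
Qed.

Let rE s : T <= s -> r s = (x s)^-1.
Proof. by move=> Ts; rewrite /r (max_idPl (x_ge Ts)). Qed.

Let xi_ge : a <= xi.
Proof.
have T1' : 0 < 1 - T by rewrite subr_gt0.
rewrite -(ler_pM2l T1') xiE mulrC -itvint_cst; last exact: ltW.
apply: itvint_le => //; first exact: lbm_cst.
by move=> t /andP[/ltW /x_ge].
Qed.

Let phi1 t := c * x t - t + k * (M t * r t) - k * (1 - t).

Let tail_phi1 s : T <= s <= 1 -> 0 <= itvint s 1 phi1.
Proof.
case/andP => Ts; rewrite le_eqVlt => /predU1P[->|s1].
  have l1 : lbm phi1 by rewrite /phi1; lbm_tac.
  have := itvint_split l1 (lexx 1) (lexx 1); lra.
have s1' : 0 < 1 - s by rewrite subr_gt0.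
pose eta := itvint s 1 x / (1 - s).
have etaE : itvint s 1 x = eta * (1 - s) by rewrite /eta divfK// gt_eqF.
have eta_xi : xi <= eta.
  rewrite /eta ler_pdivlMr//.
  have := itvint_mean_nondecreasing ndx Ts (ltW s1); rewrite -xiE => H.
  rewrite -(@ler_pM2l _ (1 - T)) ?subr_gt0//; lra.
have eta1 : eta <= 1.
  rewrite /eta ler_pdivrMr// -itvint_cst; last exact: ltW.
  apply: itvint_le => //; first exact: lbm_cst.
  by move=> t _; case/andP: (x01 t).
have eta0 : 0 < eta by apply: lt_le_trans a0 (le_trans xi_ge eta_xi).
have s0 : 0 <= s by apply: le_trans Ts; exact: ltW.
apply: le_trans (tail_integral_ge c k0 s0 (ltW s1) (x_ge Ts) eta0 etaE).
by apply: mulr_ge0; [exact: ltW|apply: N1; rewrite ?Ts ?eta_xi ?eta1 ?(ltW s1)].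
Qed.

(** The last factor results from exchanging the integrals in [\int_T^1 \int_0^s Q]: rank [t] is
    counted for [s] between [Num.max t T] and 1. *)
Let phi t := c * x t - t + (T <= t)%R%:R * (k * (M t * r t)) - k * (1 - Num.max t T).

Let lT : lbm (fun t => (T <= t)%R%:R : R).
Proof. by apply: lbm_upset => s t st /le_trans; apply. Qed.

Let lmax : lbm (fun t => Num.max t T).
Proof. by apply: lbm_nondecreasing => s t st; rewrite le_max2. Qed.

Let lphi : lbm phi. Proof. by rewrite /phi; lbm_tac. Qed.

Let phi_hi t : T <= t -> phi t = phi1 t.
Proof. by move=> Tt; rewrite /phi Tt mul1r (max_idPl Tt). Qed.

Let phi_lo t : t < T -> phi t = c * x t - t - k * (1 - T).
Proof.
by move=> tT; rewrite /phi leNgt tT /= mul0r addr0 (max_idPr (ltW tT)).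
Qed.

Let tail_phi s : 0 <= s <= 1 -> 0 <= itvint s 1 phi.
Proof.
case/andP => s0 s1; case: (leP T s) => Ts.
  rewrite (@eq_itvint _ _ _ _ phi1); first by rewrite tail_phi1// Ts.
  by move=> t /andP[st _]; rewrite phi_hi// (le_trans Ts).
have sT := ltW Ts.
rewrite (itvint_split lphi sT (ltW T1)).
have h1 : (T - s) * (c * a - k * (1 - T) - (T + s) / 2) <= itvint s T phi.
  have : itvint s T (fun t => c * x t - t - k * (1 - T)) <= itvint s T phi.
    apply: itvint_le => //; first by lbm_tac.
    by move=> t /andP[_ tT]; rewrite phi_lo.
  apply: le_trans.
  rewrite !itvintB ?itvintZ ?itvint_cst ?itvint_id//; try by lbm_tac.
  have := itvint_mean_nondecreasing ndx s0 sT; rewrite -aE subr0 => H.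
  have H' : (T - s) * a <= itvint s T x.
    by rewrite -(ler_pM2l T0); lra.
  by have := ler_wpM2l c0 H'; lra.
have h2 : (1 - T) * ((c - k / 2) * xi + k / 2 / xi - 1 + (2^-1 - k) * (1 - T)
     - k / 6 * (xi / a) ^+ 2 * (1 - T) ^+ 2) <= itvint T 1 phi.
  rewrite (@eq_itvint _ _ _ _ phi1); last first.
    by move=> t /andP[tT _]; rewrite phi_hi.
  apply: tail_integral_ge => //; [exact: ltW|exact: ltW|exact: x_ge|exact: lt_le_trans a0 xi_ge|].
  by rewrite -xiE mulrC.
have := N2; move=> /(_ s); rewrite s0 sT => /(_ isT); lra.
Qed.

Theorem rank_output_le :
  itvint 0 1 (fun t => t * Q t) <= c * itvint 0 1 (fun t => x t * Q t).
Proof.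
have main := nondecreasing_tail_ge0 ndQ Q01 lphi tail_phi.
have T0' := ltW T0; have T1' := ltW T1.
have lQp : lbm (fun t => Q t * phi t) by lbm_tac.
have lh : lbm (fun t => itvint 0 t Q).
  apply: lbm_nondecreasing; apply: itvint_head_nondecreasing => // t.
  by case/andP: (Q01 t).
have lo : itvint 0 T (fun t => Q t * phi t) <=
    c * itvint 0 T (fun t => x t * Q t) - itvint 0 T (fun t => t * Q t)
    - k * (1 - T) * itvint 0 T Q.
  rewrite -!itvintZ -?itvintB; try by lbm_tac.
  apply: itvint_le => //; first by lbm_tac.
  by move=> t /andP[_ tT]; rewrite phi_lo//; lra.
pose h t := itvint 0 t Q.
(* Above [T], [C1] divided by [x t] trades [Q t * M t / x t] for the cumulative quality [h t]. *)
have hi : itvint T 1 (fun t => Q t * phi t) <=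
    c * itvint T 1 (fun t => x t * Q t) - itvint T 1 (fun t => t * Q t)
    + k * itvint T 1 h - k * (itvint T 1 Q - itvint T 1 (fun t => t * Q t)).
  rewrite -itvintB -?itvintZ -?itvintB -?itvintD -?itvintB; try by lbm_tac.
  apply: itvint_le => //; first by lbm_tac.
  move=> t /andP[/ltW Tt t1]; rewrite phi_hi// /phi1 rE//.
  have x0 : 0 < x t by apply: lt_le_trans a0 (x_ge Tt).
  have : Q t * M t / x t <= h t.
    by rewrite ler_pdivrMr// [h t * _]mulrC; apply: C1; rewrite t1 (lt_le_trans T0).
  move=> /(ler_wpM2l k0); lra.
(* Writing [h] as the total minus a tail integral makes Tonelli on [T, 1] applicable. *)
have hE : itvint T 1 h = (1 - T) * itvint 0 1 Q
    - (itvint T 1 (fun t => t * Q t) - T * itvint T 1 Q).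
  rewrite (@eq_itvint _ _ _ _ (fun t => itvint 0 1 Q - itvint t 1 Q)); last first.
    move=> t /andP[Tt t1]; rewrite (itvint_split lQ _ t1) ?(le_trans T0')//.
    by rewrite /h; ring.
  rewrite itvintB ?itvint_cst//; [|by lbm_tac|]; last first.
    apply: lbm_nonincreasing; apply: itvint_tail_nonincreasing => // t.
    by case/andP: (Q01 t).
  rewrite itvint_tonelli//; last by move=> t; case/andP: (Q01 t).
  rewrite -itvintZ -?itvintB; try by lbm_tac.
  rewrite [_ * (1 - T)]mulrC; congr (_ - _).
  by apply: eq_itvint => t _; ring.
have sp f : lbm f -> itvint 0 1 f = itvint 0 T f + itvint T 1 f.
  by move=> lf; exact: itvint_split.
move: main; rewrite (sp _ lQp).
have l1 : lbm (fun t => x t * Q t) by lbm_tac.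
have l2 : lbm (fun t => t * Q t) by lbm_tac.
rewrite (sp _ l1) (sp _ l2).
rewrite hE (sp _ lQ) in hi.
lra.
Qed.

End Ranks.

(* [xi] and [a] stand for the means of [x] on [3/5, 1] and [0, 3/5]; the relation
   between them says that [x] has mean 1/2. *)
Section Numeric.
Local Open Scope classical_set_scope.
Local Open Scope ring_scope.
Context {R : realType}.
Implicit Types (xi eta s a e k : R).

(** By convexity the inverse lies above its tangent at [u]; this makes the rational inequalities
    below polynomial. *)
Lemma inv_ge_tangent e (u : R) : 0 < e -> 0 < u -> 2 / u - e / u ^+ 2 <= e^-1.
Proof.
move=> e0 u0; rewrite -(ler_pM2r e0) mulVf ?gt_eqF//.
have E : (2 / u - e / u ^+ 2) * e = 1 - (1 - e / u) ^+ 2.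
  by field; rewrite gt_eqF.
by rewrite E gerBl sqr_ge0.
Qed.

Lemma ratio_sqr_le e a (K : R) : 0 < a -> e ^+ 2 <= K * a ^+ 2 -> (e / a) ^+ 2 <= K.
Proof. by move=> a0 h; rewrite expr_div_n ler_pdivrMr// exprn_gt0. Qed.

(** The minimum over [v] is at [v = p]. With [v = 3 / 5 - s] this eliminates [s], where [p] is
    [3 / 5 + k * (1 - 3 / 5) - 136 / 100 * a]. *)
Lemma quadratic_ge (v p A : R) : p ^+ 2 / 2 <= A -> 0 <= A + v * (v / 2 - p).
Proof. by have := sqr_ge0 (v - p); move=> h1 h2; nra. Qed.

(** With [9 / 20] replaced by [k], the case [s = 1], [eta = 1 / 2] reads [k >= 32 / 75], which
    [9 / 20] barely exceeds. *)
Lemma low_tail_ge0 xi eta s a : 2^-1 <= xi <= 3 / 5 -> a = 5 / 6 - 2 / 3 * xi ->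
  3 / 5 <= s <= 1 -> xi <= eta <= 1 ->
  0 <= (136 / 100 - 9 / 20 / 2) * eta + 9 / 20 / 2 / eta - 1
     + (2^-1 - 9 / 20) * (1 - s) - 9 / 20 / 6 * (eta / a) ^+ 2 * (1 - s) ^+ 2.
Proof.
move=> /andP[x1 x2] aE /andP[s1 s2] /andP[e1 e2].
have a1 : 13 / 30 <= a by lra.
have e0 : 0 < eta by lra.
(* [54 / 10] rounds up [(30 / 13) ^+ 2], the largest value of [1 / a ^+ 2]. *)
have K : (eta / a) ^+ 2 <= 54 / 10 * eta ^+ 2.
  apply: ratio_sqr_le; first by lra.
  by rewrite mulrAC -[leLHS]mul1r ler_wpM2r ?sqr_ge0//; nra.
have T := @inv_ge_tangent eta (1 / 2) e0 ltac:(lra).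
have E : 2 / (1 / 2) - eta / (1 / 2) ^+ 2 = 4 - 4 * eta :> R by field.
rewrite E in T.
have L : (1 - s) ^+ 2 <= 16 / 100 by nra.
have L0 : 0 <= (1 - s) ^+ 2 by exact: sqr_ge0.
have P : (eta / a) ^+ 2 * (1 - s) ^+ 2 <= 54 / 10 * eta ^+ 2 * (16 / 100).
  by apply: ler_pM => //; exact: sqr_ge0.
nra.
Qed.

Lemma low_head_ge0 xi s a : 2^-1 <= xi <= 3 / 5 -> a = 5 / 6 - 2 / 3 * xi ->
  0 <= (1 - 3 / 5) * ((136 / 100 - 9 / 20 / 2) * xi + 9 / 20 / 2 / xi - 1
     + (2^-1 - 9 / 20) * (1 - 3 / 5) - 9 / 20 / 6 * (xi / a) ^+ 2 * (1 - 3 / 5) ^+ 2)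
   + (3 / 5 - s) * (136 / 100 * a - 9 / 20 * (1 - 3 / 5) - (3 / 5 + s) / 2).
Proof.
move=> /andP[x1 x2] aE.
have x0 : 0 < xi by lra.
(* A chord rounded up: exact at [xi = 1 / 2], and 1.92 against [(18 / 13) ^+ 2] at [xi = 3 / 5]. *)
have K : (xi / a) ^+ 2 <= 1 + 92 / 10 * (xi - 1 / 2).
  apply: ratio_sqr_le; rewrite aE; first by lra.
  rewrite -subr_ge0; pose d := xi - 1 / 2.
  have -> : (1 + 92 / 10 * (xi - 1 / 2)) * (5 / 6 - 2 / 3 * xi) ^+ 2 - xi ^+ 2
    = d * (19 / 30 - 301 / 45 * d + 184 / 45 * d ^+ 2) by rewrite /d; field.
  by apply: mulr_ge0; rewrite /d; nra.
(* The tangent point is near the upper end of the range, where the least slack remains. *)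
have T := @inv_ge_tangent xi (58 / 100) x0 ltac:(lra).
pose A := (1 - 3 / 5) * ((136 / 100 - 9 / 20 / 2) * xi
     + 9 / 20 / 2 * (2 / (58 / 100) - xi / (58 / 100) ^+ 2) - 1
     + (2^-1 - 9 / 20) * (1 - 3 / 5)
     - 9 / 20 / 6 * (1 + 92 / 10 * (xi - 1 / 2)) * (1 - 3 / 5) ^+ 2).
have := @quadratic_ge (3 / 5 - s) (78 / 100 - 136 / 100 * a) A.
have pA : (78 / 100 - 136 / 100 * a) ^+ 2 / 2 <= A by rewrite /A aE; nra.
move=> /(_ pA); rewrite /A; lra.
Qed.

(** With [9 / 25] replaced by [k], the case [s = 1], [eta = 3 / 5] reads [k >= 69 / 200]. The weight
    [9 / 20] would satisfy this too, but violates the companion head estimate at [xi = 25 / 34]. *)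
Lemma mid_tail_ge0 xi eta s a : 3 / 5 <= xi <= 25 / 34 -> a = 5 / 6 - 2 / 3 * xi ->
  3 / 5 <= s <= 1 -> xi <= eta <= 1 ->
  0 <= (136 / 100 - 9 / 25 / 2) * eta + 9 / 25 / 2 / eta - 1
     + (2^-1 - 9 / 25) * (1 - s) - 9 / 25 / 6 * (eta / a) ^+ 2 * (1 - s) ^+ 2.
Proof.
move=> /andP[x1 x2] aE /andP[s1 s2] /andP[e1 e2].
have a1 : 343 / 1000 <= a by lra.
have e0 : 0 < eta by lra.
(* [85 / 10] rounds up [1 / a ^+ 2] at [a = 343 / 1000]; then [eta ^+ 2 <= eta] makes the bound
   linear. *)
have K : (eta / a) ^+ 2 <= 85 / 10 * eta.
  apply: ratio_sqr_le; first by lra.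
  have h : 1 <= 85 / 10 * a ^+ 2 by nra.
  by nra.
have T := @inv_ge_tangent eta (3 / 5) e0 ltac:(lra).
have E : 2 / (3 / 5) - eta / (3 / 5) ^+ 2 = 10 / 3 - 25 / 9 * eta :> R by field.
rewrite E in T.
have L : (1 - s) ^+ 2 <= 4 / 10 * (1 - s) by nra.
have P : (eta / a) ^+ 2 * (1 - s) ^+ 2 <= 85 / 10 * eta * (4 / 10 * (1 - s)).
  by apply: ler_pM => //; exact: sqr_ge0.
nra.
Qed.

Lemma mid_head_ge0 xi s a : 3 / 5 <= xi <= 25 / 34 -> a = 5 / 6 - 2 / 3 * xi ->
  0 <= (1 - 3 / 5) * ((136 / 100 - 9 / 25 / 2) * xi + 9 / 25 / 2 / xi - 1
     + (2^-1 - 9 / 25) * (1 - 3 / 5) - 9 / 25 / 6 * (xi / a) ^+ 2 * (1 - 3 / 5) ^+ 2)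
   + (3 / 5 - s) * (136 / 100 * a - 9 / 25 * (1 - 3 / 5) - (3 / 5 + s) / 2).
Proof.
move=> /andP[x1 x2] aE.
have x0 : 0 < xi by lra.
(* Again a chord rounded up: the true values at the two ends are [(18 / 13) ^+ 2] and
   [(15 / 7) ^+ 2]. *)
have K : (xi / a) ^+ 2 <= 192 / 100 + 20 * (xi - 3 / 5).
  apply: ratio_sqr_le; rewrite aE; first by lra.
  rewrite -subr_ge0; pose d := xi - 3 / 5.
  have -> : (192 / 100 + 20 * (xi - 3 / 5)) * (5 / 6 - 2 / 3 * xi) ^+ 2 - xi ^+ 2
    = (192 / 100 * (169 / 900) - 36 / 100)
      + d * ((- (192 / 100) * (26 / 45) + 20 * (169 / 900) - 6 / 5)
      - (1 + 20 * (26 / 45) - 192 / 100 * (4 / 9)) * d + 80 / 9 * d ^+ 2)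
    by rewrite /d; field.
  by apply: addr_ge0; [lra|apply: mulr_ge0; rewrite /d; nra].
have T := @inv_ge_tangent xi (65 / 100) x0 ltac:(lra).
pose A := (1 - 3 / 5) * ((136 / 100 - 9 / 25 / 2) * xi
     + 9 / 25 / 2 * (2 / (65 / 100) - xi / (65 / 100) ^+ 2) - 1
     + (2^-1 - 9 / 25) * (1 - 3 / 5)
     - 9 / 25 / 6 * (192 / 100 + 20 * (xi - 3 / 5)) * (1 - 3 / 5) ^+ 2).
have := @quadratic_ge (3 / 5 - s) (744 / 1000 - 136 / 100 * a) A.
have pA : (744 / 1000 - 136 / 100 * a) ^+ 2 / 2 <= A by rewrite /A aE; nra.
move=> /(_ pA); rewrite /A; lra.
Qed.

Theorem rank_output_le_136 (x Q : R -> R) : nondecreasing_fun x ->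
  (forall t, 0 <= x t <= 1) -> nondecreasing_fun Q -> (forall t, 0 <= Q t <= 1) ->
  itvint 0 1 x = 2^-1 ->
  (forall s, 0 < s < 1 ->
    Q s * ((1 - x s ^+ 2) / 2 - itvint s 1 x) <= x s * itvint 0 s Q) ->
  itvint 0 1 (fun t => t * Q t) <= 136 / 100 * itvint 0 1 (fun t => x t * Q t).
Proof.
move=> ndx x01 ndQ Q01 mean C1.
have lx := lbm_nondecreasing ndx.
have T0 : 0 < 3 / 5 :> R by lra.
have T1 : 3 / 5 < 1 :> R by lra.
pose a := itvint 0 (3 / 5) x / (3 / 5); pose xi := itvint (3 / 5) 1 x / (1 - 3 / 5).
have aE : 3 / 5 * a = itvint 0 (3 / 5) x by rewrite /a mulrC divfK// gt_eqF.
have xiE : (1 - 3 / 5) * xi = itvint (3 / 5) 1 x.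
  by rewrite /xi mulrC divfK// gt_eqF// subr_gt0.
have sum : 3 / 5 * a + (1 - 3 / 5) * xi = 2^-1.
  by rewrite aE xiE -mean (itvint_split lx (ltW T0) (ltW T1)).
have a_xi : a = 5 / 6 - 2 / 3 * xi by lra.
have xi_half : 2^-1 <= xi.
  have := itvint_mean_nondecreasing ndx (ltW T0) (ltW T1).
  by rewrite -xiE mean; lra.
have xi1 : xi <= 1.
  rewrite -(@ler_pM2l _ (1 - 3 / 5)) ?subr_gt0// xiE [leRHS]mulrC -itvint_cst; last exact: ltW.
  apply: itvint_le => //; first exact: lbm_cst.
  by move=> t _; case/andP: (x01 t).
have a0 : 0 < a by lra.
have c0 : 0 <= 136 / 100 :> R by lra.
have [xi_lo|xi_hi] := leP xi (3 / 5).
  have k0 : 0 <= 9 / 20 :> R by lra.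
  apply: (rank_output_le ndx x01 a0 ndQ Q01 c0 k0 T0 T1 C1 aE xiE).
  - by move=> s eta; apply: low_tail_ge0; rewrite ?xi_half.
  - by move=> s _; apply: low_head_ge0; rewrite ?xi_half.
(* Since [136 / 100 * (25 / 34) = 1], beyond this value the tails are nonnegative already with
   [k = 0]. *)
have [xi_mid|xi_top] := leP xi (25 / 34).
  have k0 : 0 <= 9 / 25 :> R by lra.
  apply: (rank_output_le ndx x01 a0 ndQ Q01 c0 k0 T0 T1 C1 aE xiE).
  - by move=> s eta; apply: mid_tail_ge0; rewrite ?(ltW xi_hi).
  - by move=> s _; apply: mid_head_ge0; rewrite ?(ltW xi_hi).
apply: (rank_output_le ndx x01 a0 ndQ Q01 c0 (lexx 0) T0 T1 C1 aE xiE).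
- move=> s eta /andP[s1 s2] /andP[e1 e2]; rewrite !mul0r; lra.
- move=> s _; rewrite !mul0r.
  have := @quadratic_ge (3 / 5 - s) (6 / 10 - 136 / 100 * a) (544 / 1000 * xi - 32 / 100).
  have pA : (6 / 10 - 136 / 100 * a) ^+ 2 / 2 <= 544 / 1000 * xi - 32 / 100.
    by rewrite a_xi; nra.
  by move=> /(_ pA); lra.
Qed.

End Numeric.

(** * Quantile functions *)

Section Quantile.
Local Open Scope classical_set_scope.
Context {R : realType}.
Notation mu := (@lebesgue_measure R).
Implicit Types (P : probability R R) (t x y : R).

Lemma probability_eq_of_rays P1 P2 : (forall x, P1 `]-oo, x] = P2 `]-oo, x]) ->
  forall A : set R, measurable A -> P1 A = P2 A.
Proof.
move=> P12; pose g (n : nat) : set R := `](- n%:R), +oo[.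
apply: (@measure_unique _ _ _ (@RGenOInfty.G R) g).
- exact: RGenOInfty.measurableE.
- move=> _ _ [x ->] [y ->]; exists (Num.max x y).
  rewrite eqEsubset; split => z /=; rewrite !in_itv /= !andbT gt_max.
    by move=> [-> ->].
  by move=> /andP[].
- by move=> n; exists (- n%:R).
- rewrite -subTset => x _; exists (Num.truncn (- x)).+1 => //=.
  by rewrite /g /= in_itv /= andbT ltrNl truncnS_gt.
- move=> _ [x ->]; have -> : `]x, +oo[%classic = ~` (`]-oo, x]%classic : set R).
    by rewrite setCitvl.
  transitivity (1 - P1 `]-oo, x])%E; first exact: probability_setC.
  by rewrite P12; apply/esym; exact: probability_setC.
- move=> n; apply: (@le_lt_trans _ _ 1%E); last exact: ltry.
  by apply: probability_le1; rewrite /g.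
Qed.

Definition cdf_of P x : R := fine (P `]-oo, x]).
Definition quantile_of P t : R := inf [set x | t <= cdf_of P x].

Variable P : probability R R.
Hypothesis P01 : P `[0, 1] = 1%E.
Notation F := (cdf_of P).
Notation q := (quantile_of P).

Lemma cdf_ofE x : (F x)%:E = P `]-oo, x].
Proof. by rewrite fineK// fin_num_measure. Qed.

Lemma cdf_of_nondecreasing : nondecreasing_fun F.
Proof.
move=> x y xy; rewrite -lee_fin !cdf_ofE le_measure ?inE//.
by apply: subset_itvl; rewrite bnd_simp.
Qed.

Lemma cdf_of_itv x : 0 <= F x <= 1.
Proof. by rewrite -!lee_fin cdf_ofE measure_ge0 probability_le1. Qed.

Lemma cdf_of_lt0 x : x < 0 -> F x = 0.
Proof.
move=> x0; apply: EFin_inj; rewrite cdf_ofE; apply/eqP; rewrite eq_le measure_ge0 andbT.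
have : (P `]-oo, x] + P `[0%R, 1%R] <= 1)%E.
  rewrite -measureU//; first exact: probability_le1 (measurableU _ _ _ _).
  rewrite -subset0 => z /= []; rewrite !in_itv /= => zx /andP[z0 _].
  by move: (le_lt_trans z0 (le_lt_trans zx x0)); rewrite ltxx.
rewrite P01 -cdf_ofE -EFinD !lee_fin; lra.
Qed.

Lemma cdf_of1 x : 1 <= x -> F x = 1.
Proof.
move=> x1; apply: EFin_inj; rewrite cdf_ofE; apply/eqP; rewrite eq_le probability_le1//=.
rewrite -P01 le_measure ?inE// => z /=; rewrite !in_itv /= => /andP[_ z1].
exact: le_trans x1.
Qed.

Lemma cdf_of_right_limit x t : (forall n : nat, t <= F (x + n.+1%:R^-1)) -> t <= F x.
Proof.
move=> H; have cv : P `]-oo, (x + n.+1%:R^-1)] @[n --> \oo] --> P `]-oo, x].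
  rewrite [in X in _ --> X](itvNycEbigcap false).
  apply: nonincreasing_cvg_mu => //.
  - by rewrite (le_lt_trans (probability_le1 _ _)) ?ltry.
  - by apply: bigcap_measurable => // n _.
  - move=> m n mn; apply/subsetPset; apply: subset_itvl.
    by rewrite bnd_simp lerD2l lef_pV2 ?posrE// ler_nat.
rewrite -lee_fin cdf_ofE -(cvg_lim _ cv)//.
apply: lime_ge; first by apply/cvg_ex; exists (P `]-oo, x]).
by apply: nearW => n; rewrite -cdf_ofE lee_fin.
Qed.

Lemma cdf_of_left_limit x t : P [set x] = 0%E ->
  (forall y, y < x -> F y <= t) -> F x <= t.
Proof.
move=> Px H.
have cv : P `]-oo, (x - n.+1%:R^-1)] @[n --> \oo] --> P `]-oo, x[.
  rewrite [in X in _ --> X](_ : `]-oo, x[%classic = \bigcup_n `]-oo, (x - n.+1%:R^-1)]).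
    apply: nondecreasing_cvg_mu => //; first exact: bigcup_measurable.
    move=> m n mn; apply/subsetPset; apply: subset_itvl.
    by rewrite bnd_simp lerD2l lerN2 lef_pV2 ?posrE// ler_nat.
  rewrite eqEsubset; split => z /=; rewrite in_itv /=.
    move=> zx; exists (Num.truncn (x - z)^-1) => //=; rewrite in_itv /=.
    rewrite lerBrDr -lerBrDl -[leRHS]invrK lef_pV2 ?posrE ?invr_gt0 ?subr_gt0//.
    by apply: ltW; apply: truncnS_gt.
  by move=> [n _ /=]; rewrite in_itv /= => /le_lt_trans; apply; rewrite ltrBlDr ltrDl invr_gt0.
rewrite -lee_fin cdf_ofE.
have -> : `]-oo, x]%classic = `]-oo, x[ `|` [set x].
  by rewrite setUitv1.
apply: (@le_trans _ _ (P `]-oo, x[ + P [set x])%E); first exact: measureU2.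
rewrite Px adde0 -(cvg_lim _ cv)//.
apply: lime_le; first by apply/cvg_ex; exists (P `]-oo, x[).
apply: nearW => n; rewrite -cdf_ofE lee_fin; apply: H.
by rewrite ltrBlDr ltrDl invr_gt0.
Qed.

Lemma quantile_set_inf t : 0 < t -> t <= 1 -> has_inf [set x | t <= F x].
Proof.
move=> t0 t1; split; first by exists 1 => /=; rewrite cdf_of1.
exists 0 => x /= tx; rewrite leNgt; apply/negP => /cdf_of_lt0 E; lra.
Qed.

(** Right continuity makes the infimum attained. This Galois connection yields the range, the
    monotonicity and the inversion formula below. *)
Lemma quantile_le t x : 0 < t -> t <= 1 -> (q t <= x) = (t <= F x).
Proof.
move=> t0 t1; have hi := quantile_set_inf t0 t1.
apply/idP/idP => [qx|tx]; last exact: ge_inf hi.2 _ tx.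
apply: cdf_of_right_limit => n.
have : q t < x + n.+1%:R^-1 by rewrite (le_lt_trans qx)// ltrDl invr_gt0.
by move=> /(inf_lt hi.1)[u /= tu /ltW /cdf_of_nondecreasing]; exact: le_trans.
Qed.

Lemma quantile_itv t : 0 < t -> t <= 1 -> 0 <= q t <= 1.
Proof.
move=> t0 t1; rewrite quantile_le// cdf_of1// t1 andbT leNgt; apply/negP => h.
have := lexx (q t); rewrite quantile_le// cdf_of_lt0//; lra.
Qed.

Lemma quantile_nondecreasing s t : 0 < s -> s <= t -> t <= 1 -> q s <= q t.
Proof.
move=> s0 st t1; have t0 := lt_le_trans s0 st; have s1 := le_trans st t1.
by rewrite quantile_le// (le_trans st)// -quantile_le.
Qed.

Lemma cdf_of_quantile t : 0 < t -> t <= 1 -> P [set q t] = 0%E -> F (q t) = t.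
Proof.
move=> t0 t1 P0; apply/eqP; rewrite eq_le -(quantile_le (q t)) ?lexx ?andbT//.
apply: cdf_of_left_limit => // y; rewrite ltNge quantile_le// -ltNge; exact: ltW.
Qed.

(* [quantile_of P t] is a junk infimum when [t <= 0] or [1 < t]; the values put
   there keep the function nondecreasing on the whole line. *)
Definition total_quantile t : R := if t <= 0 then 0 else if t <= 1 then q t else 1.

Lemma total_quantile_itv t : 0 <= total_quantile t <= 1.
Proof.
rewrite /total_quantile; case: (leP t 0) => t0; first by rewrite lexx ler01.
by case: (leP t 1) => t1; [exact: quantile_itv|rewrite ler01 lexx].
Qed.

Lemma total_quantile_nondecreasing : nondecreasing_fun total_quantile.
Proof.
move=> s t st; have /andP[t0 t1] := total_quantile_itv t.
have /andP[s0 s1] := total_quantile_itv s.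
rewrite /total_quantile in t0 t1 s0 s1 *.
case: (leP s 0) => hs; first by [].
rewrite (negbTE (_ : ~~ (t <= 0))) in t0 t1 *; last by rewrite -ltNge (lt_le_trans hs).
case: (leP t 1) => ht in t0 t1 *.
  by rewrite (le_trans st ht) quantile_nondecreasing.
by move: s1; case: ifP => //; rewrite leNgt hs.
Qed.

(** Inverse transform: [P] is the image of the uniform law under its quantile function. It suffices
    to check rays, whose preimages in [0, 1] are the intervals [[0, F x]] by [quantile_le]. *)
Lemma ge0_integral_quantile (g : R -> \bar R) : measurable_fun setT g ->
  (forall x, (0 <= g x)%E) ->
  (\int[P]_x g x = \int[mu]_(t in `[0%R, 1%R]) g (total_quantile t))%E.
Proof.
move=> mg g0.
have mq : measurable_fun setT total_quantile.
  by apply: nondecreasing_measurable => //; exact: total_quantile_nondecreasing.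
pose U := uniform_prob (@ltr01 R).
have UE (A : set R) : measurable A -> U A = mu (A `&` `[0, 1]).
  move=> mA; transitivity (\int[U]_x (\1_A x)%:E)%E; first by rewrite integral_indic// setIT.
  rewrite integral_uniform//; last exact/measurable_EFinP/measurable_indic.
  by rewrite subr0 invr1 mul1e integral_indic.
have mq' : @measurable_fun _ _ (measurableTypeR R) R setT total_quantile := mq.
pose q' : {mfun measurableTypeR R >-> R} := @mfun_Sub _ _ (measurableTypeR R) R total_quantile (mem_set mq').
have PD : forall A : set R, measurable A -> P A = distribution U q' A.
  apply: probability_eq_of_rays => x.
  transitivity (mu ((total_quantile @^-1` `]-oo, x]) `&` `[0, 1])); last first.
    by apply/esym; apply: UE; rewrite -[X in measurable X]setTI; apply: mq.
  rewrite -cdf_ofE.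
  have [x0|x0] := ltP x 0.
    rewrite cdf_of_lt0// (_ : _ `&` _ = set0) ?measure0//.
    rewrite -subset0 => t [/=]; rewrite !in_itv /= => tx _.
    by have /andP[] := total_quantile_itv t; lra.
  have -> : total_quantile @^-1` `]-oo, x] `&` `[0, 1] = `[0, F x].
    rewrite eqEsubset; split => t /=; rewrite !in_itv /=.
      move=> [+ /andP[t0 t1]]; rewrite /total_quantile t0 t1 /=.
      case: (leP t 0) => // t0' tx; first by have /andP[] := cdf_of_itv x; lra.
      by rewrite -quantile_le.
    move=> /andP[t0 tF]; have t1 : t <= 1 by have /andP[_] := cdf_of_itv x; lra.
    rewrite t0 t1 /total_quantile; split => //; case: (leP t 0) => // t0'.
    by rewrite t1 quantile_le.
  rewrite lebesgue_measure_itv /= lte_fin; case: ltP => Fx; first by rewrite -EFinD subr0.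
  by congr EFin; have /andP[] := cdf_of_itv x; lra.
rewrite (eq_measure_integral (distribution U q')); last by move=> A mA _; exact: PD.
rewrite ge0_integral_distribution// integral_uniform//=; last exact: measurableT_comp.
by rewrite subr0 invr1 mul1e.
Qed.

End Quantile.

(** * The probability measure of job qualities *)

Section JobMeasure.
Local Open Scope classical_set_scope.
Context {R : realType}.
Notation mu := (@lebesgue_measure R).
Variable dens : R -> R.
Hypothesis jd : is_job_density dens.

(** The proof is an argument so that the measure and probability instances, which depend on it, can
    be attached to the function. *)
Definition job_measure of is_job_density dens : set R -> \bar R :=
  fun A => (\int[mu]_(q in A `&` `[0%R, 1%R]) (dens q)%:E)%E.
Notation J := (job_measure jd).

Let mdens : measurable_fun setT dens := jd.1.
Let dens0 q : 0 <= dens q := jd.2.1 q.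
Let mdensE (D : set R) : measurable D -> measurable_fun D (fun q => (dens q)%:E).
Proof. by move=> mD; apply/measurable_EFinP; exact: measurable_funTS. Qed.

Let job_measure0 : J set0 = 0%E.
Proof. by rewrite /job_measure set0I integral_set0. Qed.

Let job_measure_ge0 A : (0 <= J A)%E.
Proof. by apply: integral_ge0 => q _; rewrite lee_fin. Qed.

Let job_measure_sigma_additive : semi_sigma_additive J.
Proof.
move=> /= F mF tF mUF; rewrite /job_measure; apply: cvg_toP.
  apply: ereal_nondecreasing_is_cvgn => m n mn.
  by apply: lee_sum_nneg_natr => // k _ _; exact: job_measure_ge0.
rewrite setI_bigcupl ge0_integral_bigcup//=.
- by move=> k; apply: measurableI; [exact: mF|exact: measurable_itv].
- by apply: mdensE; apply: bigcup_measurable => k _; apply: measurableI; [exact: mF|exact: measurable_itv].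
- by move=> x _; rewrite lee_fin.
- exact: trivIset_setIr.
Qed.

HB.instance Definition _ := isMeasure.Build _ _ _ J
  job_measure0 job_measure_ge0 job_measure_sigma_additive.

Let job_measureT : J setT = 1%E.
Proof. by rewrite /job_measure setTI; exact: jd.2.2.2.2. Qed.

HB.instance Definition _ := @Measure_isProbability.Build _ _ R J job_measureT.

Definition job_prob : probability R R := J.

Import HBNNSimple.

Let integral_job_nnsfun (f : {nnsfun R >-> R}) :
  (\int[J]_x (f x)%:E = \int[mu]_(x in `[0%R, 1%R]) ((f x)%:E * (dens x)%:E))%E.
Proof.
have mp r : measurable (f @^-1` [set r]) by exact: measurable_funPTI.
under [LHS]eq_integral do rewrite fimfunE -fsumEFin//.
rewrite [LHS]ge0_integral_fsum//; last 2 first.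
  - by move=> r; exact/measurable_EFinP/measurableT_comp.
  - by move=> n x _; rewrite EFinM nnfun_muleindic_ge0.
under [RHS]eq_integral.
  move=> x xD; rewrite fimfunE -fsumEFin// ge0_mule_fsuml; last first.
    by move=> r; rewrite EFinM nnfun_muleindic_ge0.
  over.
rewrite [RHS]ge0_integral_fsum//; last 2 first.
  - move=> r; apply: emeasurable_funM; last exact: mdensE.
    apply/measurable_EFinP; apply: measurable_funTS.
    by apply: measurable_funM => //; apply: measurable_indic; exact: mp.
  - by move=> n x _; apply: mule_ge0; [rewrite EFinM nnfun_muleindic_ge0|rewrite lee_fin].
apply: eq_fsbigr => r _; rewrite integralZl_indic_nnsfun//= integral_indic//= setIT.
case: (leP 0 r) => r0.
  under [RHS]eq_integral do rewrite EFinM -muleA.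
  rewrite ge0_integralZl//; last 2 first.
  - apply: emeasurable_funM; last exact: mdensE.
    by apply/measurable_EFinP; apply: measurable_indic; exact: mp.
  - by move=> x _; apply: mule_ge0; rewrite lee_fin.
  congr (_ * _)%E; rewrite /job_measure setIC integral_mkcondr/=.
  apply: eq_integral => x _; rewrite patchE indicE; case: ifPn => _.
    by rewrite mul1e.
  by rewrite mul0e.
rewrite (_ : f @^-1` [set r] = set0); last first.
  rewrite -subset0 => x /= fx; have : 0 <= f x by []; rewrite fx; lra.
rewrite measure0 mule0 integral0_eq// => x _.
by rewrite indicE in_set0 mulr0 mul0e.
Qed.

Lemma ge0_integral_job (g : R -> \bar R) : measurable_fun setT g ->
  (forall x, (0 <= g x)%E) ->
  (\int[job_prob]_x g x = \int[mu]_(x in `[0%R, 1%R]) (g x * (dens x)%:E))%E.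
Proof.
move=> mf f0.
pose f_ := nnsfun_approx measurableT mf.
have mfn n : measurable_fun setT (f_ n) by exact: measurable_funPT.
transitivity (lim (\int[J]_x (f_ n x)%:E @[n --> \oo])%E).
  rewrite -monotone_convergence//=.
  - apply: eq_integral => ? /[!inE] xD; apply/esym/cvg_lim => //=.
    exact: cvg_nnsfun_approx.
  - by move=> n; exact/measurable_EFinP/measurable_funTS.
  - by move=> n ? _; rewrite lee_fin.
  - by move=> ? _ ? ? mn; rewrite lee_fin; exact/lefP/nd_nnsfun_approx.
under eq_fun do rewrite integral_job_nnsfun.
rewrite -monotone_convergence//=.
- apply: eq_integral => x _; apply/cvg_lim => //.
  apply: cvgeZr => //; exact: cvg_nnsfun_approx.
- move=> n; apply: emeasurable_funM; last exact: mdensE.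
  by apply/measurable_EFinP; apply: measurable_funTS; exact: mfn.
- by move=> n x _; rewrite mule_ge0 ?lee_fin.
- move=> x _ m n mn; apply: lee_wpmul2r; rewrite lee_fin//.
  by have /lefP := nd_nnsfun_approx measurableT mf mn; apply.
Qed.

Lemma job_prob_itv01 : job_prob `[0, 1] = 1%E.
Proof. by rewrite /= /job_measure setIid; exact: jd.2.2.2.2. Qed.

Lemma job_prob_set1 (q : R) : job_prob [set q] = 0%E.
Proof.
apply: null_set_integral => //.
- exact: measurableI.
- by apply: measurable_funTS; exact/measurable_EFinP.
- apply/eqP; rewrite eq_le measure_ge0 andbT -(lebesgue_measure_set1 q).
  by apply: le_measure; rewrite ?inE//; exact: measurableI.
Qed.

Lemma job_cdfE (x : R) : job_cdf dens x = cdf_of job_prob x.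
Proof.
rewrite /job_cdf /cdf_of /= /job_measure /Rintegral; congr fine.
rewrite integral_mkcond [RHS]integral_mkcond; apply: eq_integral => q _.
rewrite !patchE; have [q01|q01] := boolP (q \in `[0, 1]%R); last first.
  have -> : q \in `]-oo, x] `&` `[0, 1] = false.
    apply/negbTE/negP; rewrite inE /= => -[_ q01'].
    by move/negP: q01; apply.
  case: ifPn => //; rewrite inE /= in_itv /= => /andP[q0 _].
  rewrite jd.2.2.2.1//; right; rewrite ltNge; apply/negP => q1.
  by move: q01; rewrite in_itv /= q0 q1.
congr (if _ then _ else _); apply/idP/idP; rewrite !inE /= !in_itv /=.
  by move=> /andP[_ qx]; split => //; move: q01; rewrite in_itv.
by move=> [qx /andP[q0 _]]; rewrite q0.
Qed.

(** At a positive level the constraint [0 <= q] is automatic, because the distribution function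
    vanishes on negative qualities. *)
Lemma job_quantileE (t : R) : 0 < t -> job_quantile dens t = quantile_of job_prob t.
Proof.
move=> t0; rewrite /job_quantile /quantile_of; congr inf.
rewrite eqEsubset; split => q /=; rewrite job_cdfE; first by case.
move=> tq; split => //; rewrite leNgt; apply/negP => q0.
by move: tq; rewrite (cdf_of_lt0 job_prob_itv01 q0); lra.
Qed.

Lemma total_outputE (L : R -> R) : nondecreasing_fun L -> (forall q, 0 <= L q) ->
  total_output dens L = itvint 0 1 (fun t =>
    total_quantile job_prob t * L (total_quantile job_prob t)).
Proof.
(* [Num.max 0 q] is [q] on [0, 1] and makes the integrand nonnegative everywhere, as the change of
   variables requires. *)
move=> ndL L0; pose g q : \bar R := (Num.max 0 q * L q)%:E.
have mg : measurable_fun setT g.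
  apply/measurable_EFinP; apply: measurable_funM.
    by apply: nondecreasing_measurable => // s t st; rewrite le_max2.
  exact: nondecreasing_measurable.
have g0 q : (0 <= g q)%E by rewrite lee_fin mulr_ge0// le_max lexx.
have := ge0_integral_quantile job_prob_itv01 mg g0.
rewrite (ge0_integral_job mg g0) /total_output /itvint /Rintegral => E; congr fine.
transitivity (\int[mu]_(x in `[0%R, 1%R]) (g x * (dens x)%:E))%E.
  apply: eq_integral => q; rewrite inE /= in_itv /= => /andP[q0 _].
  by rewrite /g (max_idPr q0) EFinM.
rewrite E; apply: eq_integral => t _; rewrite /g.
by have /andP[q0 _] := total_quantile_itv job_prob_itv01 t; rewrite (max_idPr q0).
Qed.

Lemma job_cdf_quantile (t : R) : 0 <= t <= 1 ->
  job_cdf dens (total_quantile job_prob t) = t.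
Proof.
case/andP; rewrite le_eqVlt => /predU1P[<- _|t0 t1]; rewrite job_cdfE.
  rewrite /total_quantile lexx.
  have /andP[F0 _] := cdf_of_itv job_prob 0.
  apply/eqP; rewrite eq_le F0 andbT; apply: cdf_of_left_limit; first exact: job_prob_set1.
  by move=> y y0; rewrite cdf_of_lt0// job_prob_itv01.
rewrite /total_quantile leNgt t0 /= t1 cdf_of_quantile//; last exact: job_prob_set1.
exact: job_prob_itv01.
Qed.

End JobMeasure.

(** * Means of bounded functions and mixtures *)

Section BoundedMeasurable.
Local Open Scope classical_set_scope.
Context d (T : measurableType d) (R : realType).
Implicit Types (f g : T -> R) (P : probability T R) (A : set T).

Definition bounded_mfun f : Prop :=
  measurable_fun setT f /\ exists M, forall z, `|f z| <= M.

Definition mean P f : R := (\int[P]_z f z)%R.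

Lemma bm_integrable P f : bounded_mfun f -> P.-integrable setT (EFin \o f).
Proof.
move=> [mf [M HM]]; apply: measurable_bounded_integrable => //.
  by rewrite (le_lt_trans (probability_le1 _ _))// ltry.
exists M; split; first by rewrite num_real.
by move=> N MN z _; exact: le_trans (HM z) (ltW MN).
Qed.

Lemma bm_cst (c : R) : bounded_mfun (fun=> c).
Proof. by split => //; exists `|c|. Qed.

Lemma bm_indic A : measurable A -> bounded_mfun (\1_A : T -> R).
Proof.
move=> mA; split; first exact: measurable_indic.
by exists 1 => z; rewrite indicE ger0_norm// lern1 leq_b1.
Qed.

Lemma bmD f g : bounded_mfun f -> bounded_mfun g -> bounded_mfun (fun z => f z + g z).
Proof.
move=> [mf [M HM]] [mg [N HN]]; split; first exact: measurable_funD.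
by exists (M + N) => z; rewrite (le_trans (ler_normD _ _))// lerD.
Qed.

Lemma bmM f g : bounded_mfun f -> bounded_mfun g -> bounded_mfun (fun z => f z * g z).
Proof.
move=> [mf [M HM]] [mg [N HN]]; split; first exact: measurable_funM.
by exists (M * N) => z; rewrite normrM ler_pM.
Qed.

Lemma bmB f g : bounded_mfun f -> bounded_mfun g -> bounded_mfun (fun z => f z - g z).
Proof.
move=> bf bg; have -> : (fun z => f z - g z) = (fun z => f z + (-1) * g z).
  by apply/funext => z; rewrite mulN1r.
by apply: bmD => //; apply: bmM => //; exact: bm_cst.
Qed.

Lemma meanE P f : bounded_mfun f -> (mean P f)%:E = (\int[P]_z (f z)%:E)%E.
Proof.
by move=> bf; rewrite /mean /Rintegral fineK//; apply: integrable_fin_num => //; exact: bm_integrable.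
Qed.

Lemma meanD P f g : bounded_mfun f -> bounded_mfun g ->
  mean P (fun z => f z + g z) = mean P f + mean P g.
Proof. by move=> bf bg; rewrite /mean RintegralD//; exact: bm_integrable. Qed.

Lemma meanB P f g : bounded_mfun f -> bounded_mfun g ->
  mean P (fun z => f z - g z) = mean P f - mean P g.
Proof. by move=> bf bg; rewrite /mean RintegralB//; exact: bm_integrable. Qed.

Lemma meanZ P (c : R) f : bounded_mfun f -> mean P (fun z => c * f z) = c * mean P f.
Proof. by move=> bf; rewrite /mean RintegralZl//; exact: bm_integrable. Qed.

Lemma mean_cst P (c : R) : mean P (fun=> c) = c.
Proof. by rewrite /mean Rintegral_cst//= probability_setT mulr1. Qed.

Lemma mean_le P f g : bounded_mfun f -> bounded_mfun g ->
  (forall z, f z <= g z) -> mean P f <= mean P g.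
Proof.
by move=> bf bg fg; apply: le_Rintegral => //; exact: bm_integrable.
Qed.

Lemma mean_ge0 P f : (forall z, 0 <= f z) -> 0 <= mean P f.
Proof. by move=> f0; apply: Rintegral_ge0. Qed.

Lemma mean_indic P A : measurable A -> (mean P \1_A)%:E = P A.
Proof.
by move=> mA; rewrite meanE; [rewrite integral_indic// setIT|exact: bm_indic].
Qed.

Lemma mean_ae P f g A : measurable A -> P A = 1%E ->
  measurable_fun setT f -> bounded_mfun g -> (forall z, A z -> f z = g z) ->
  (\int[P]_z (f z)%:E = (mean P g)%:E)%E.
Proof.
move=> mA PA mf bg fg; rewrite meanE//; apply: ae_eq_integral => //.
- exact/measurable_EFinP.
- by apply/measurable_EFinP; exact: bg.1.
exists (~` A); split; first exact: measurableC.
  by apply: (eq_trans (probability_setC P mA)); rewrite PA subee.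
by move=> z /= h Az; apply: h => _; rewrite fg.
Qed.

End BoundedMeasurable.

Section Mixture.
Local Open Scope classical_set_scope.
Context d (T : measurableType d) (R : realType).

Lemma mixture_exists n (w : 'I_n -> R) (P : 'I_n -> probability T R) :
  (forall i, 0 <= w i) -> \sum_(i < n) w i = 1 ->
  exists M : probability T R,
    (forall A, measurable A -> M A = (\sum_(i < n) (w i)%:E * P i A)%E) /\
    (forall f, bounded_mfun f -> mean M f = \sum_(i < n) w i * mean (P i) f).
Proof.
move=> w0 w1.
pose m (k : nat) : {measure set T -> \bar R} :=
  if insub k is Some i then mscale (NngNum (w0 i)) (P i) else mzero.
have mE A : msum m n A = (\sum_(i < n) (w i)%:E * P i A)%E.
  by rewrite /msum; apply: eq_bigr => i _; rewrite /m valK.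
have mT : msum m n setT = 1%E.
  rewrite mE; under eq_bigr do rewrite probability_setT mule1.
  by rewrite sumEFin w1.
pose H := Measure_isProbability.Build _ _ _ (msum m n) mT.
pose M : probability T R := HB.pack (msum m n) H.
have int_M f : measurable_fun setT f -> (forall z, 0 <= f z)%E ->
    (\int[M]_z f z = \sum_(i < n) (w i)%:E * \int[P i]_z f z)%E.
  move=> mf f0; rewrite ge0_integral_measure_sum//; apply: eq_bigr => i _.
  by rewrite /m valK ge0_integral_mscale.
exists M; split; first by move=> A _; rewrite -mE.
(* [int_M] covers nonnegative functions; adding the bound [K] reaches [f], and [K] cancels because
   the weights sum to 1. *)
move=> f bf; have [K HK] := bf.2.
have bK : bounded_mfun (fun _ : T => K : R) by exact: bm_cst.
have bfK := bmD bf bK.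
have := int_M (fun z => (f z + K)%:E) _ _.
rewrite -meanE// meanD// mean_cst.
under eq_bigr do rewrite -meanE// meanD// mean_cst -EFinM mulrDr.
rewrite sumEFin big_split /= -mulr_suml w1 mul1r => E.
have {}E : (mean M f + K)%:E = (\sum_(i < n) w i * mean (P i) f + K)%:E.
  apply: E; first by apply/measurable_EFinP; exact: bfK.1.
  move=> z; rewrite lee_fin; have := HK z; rewrite ler_norml; lra.
by case: E; lra.
Qed.

End Mixture.

Section Pushforward.
Local Open Scope classical_set_scope.
Context d d' (T : measurableType d) (T' : measurableType d') (R : realType).

Lemma bm_comp (h : T -> T') (f : T' -> R) : measurable_fun setT h ->
  bounded_mfun f -> bounded_mfun (fun z => f (h z)).
Proof.
by move=> mh [mf [M HM]]; split; [exact: measurableT_comp|exists M].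
Qed.

Lemma pushforward_exists (P : probability T R) (h : T -> T') : measurable_fun setT h ->
  exists Q : probability T' R,
    (forall A, Q A = P (h @^-1` A)) /\
    (forall f, bounded_mfun f -> mean Q f = mean P (fun z => f (h z))).
Proof.
move=> mh; pose X : {mfun T >-> T'} := mfun_Sub (mem_set mh).
exists (distribution P X); split => // f bf.
rewrite /mean /Rintegral integral_distribution//; first exact/measurable_EFinP/bf.1.
exact: (bm_integrable P (bm_comp mh bf)).
Qed.

End Pushforward.

Ltac bm_tac := repeat first [ assumption | exact: bm_cst | apply: bmB | apply: bmD
  | apply: bmM ].

(** * Deviations of one school *)

Section Transcripts.
Local Open Scope classical_set_scope.
Context {R : realType}.
Implicit Types (A B : set R) (P : probability R R) (pi : probability (R * R)%type R).

(** Abilities and labels lie in [0, 1] almost surely, so clamping changes no mean, while it makes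
    every integrand bounded. *)
Definition clamp (a : R) : R := Num.min 1 (Num.max 0 a).

Lemma clamp_itv a : 0 <= clamp a <= 1.
Proof. by rewrite /clamp le_min ler01 le_max lexx /= ge_min lexx. Qed.

Lemma clamp_id a : 0 <= a <= 1 -> clamp a = a.
Proof. by move=> /andP[a0 a1]; rewrite /clamp (max_idPr a0) (min_idPr a1). Qed.

Lemma clamp_nondecreasing : nondecreasing_fun clamp.
Proof. by move=> s t st; rewrite /clamp le_min2// le_max2. Qed.

Lemma measurable_clamp : measurable_fun setT clamp.
Proof. by apply: nondecreasing_measurable => //; exact: clamp_nondecreasing. Qed.

Lemma bm_clamp d (T : measurableType d) (h : T -> R) : measurable_fun setT h ->
  bounded_mfun (fun z => clamp (h z)).
Proof.
move=> mh; split; first by apply: measurableT_comp => //; exact: measurable_clamp.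
by exists 1 => z; have /andP[c0 c1] := clamp_itv (h z); rewrite ger0_norm.
Qed.

Lemma bm_ind d (T : measurableType d) (h : T -> R) B : measurable_fun setT h ->
  measurable B -> bounded_mfun (fun z => \1_B (h z) : R).
Proof. by move=> mh mB; apply: (@bm_comp _ _ T R R h (\1_B)) => //; exact: bm_indic. Qed.

Let m1 : measurable_fun setT (fun z : R * R => z.1) := measurable_fst.
Let m2 : measurable_fun setT (fun z : R * R => z.2) := measurable_snd.
Let c1 := bm_clamp m1.
Let c2 := bm_clamp m2.

Lemma integral_slice pi B (A : set (R * R)) (h g : R * R -> R) : measurable B ->
  measurable A -> pi A = 1%E -> measurable_fun setT h -> bounded_mfun g ->
  (forall z, A z -> h z = g z) ->
  (\int[pi]_(z in setT `*` B) (h z)%:E = (mean pi (fun z => \1_B z.2 * g z))%:E)%E.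
Proof.
move=> mB mA A1 mh bg hg.
have bB := bm_ind m2 mB.
rewrite -(@mean_ae _ _ _ pi (fun z => \1_B z.2 * h z) _ A)//.
- rewrite integral_mkcond; apply: eq_integral => z _; rewrite patchE indicE.
  have [zB|zB] := boolP (z.2 \in B).
    by rewrite mem_set ?mul1r//; split => //; rewrite inE in zB.
  by rewrite memNset ?mul0r// => -[_ zB']; rewrite mem_set in zB.
- by apply: measurable_funM => //; exact: bB.1.
- exact: bmM.
- by move=> z Az; rewrite hg.
Qed.

Variables (P : probability R R).
Hypothesis P01 : P `[0, 1] = 1%E.

Let ability01 pi : (forall A, measurable A -> pi (A `*` setT) = P A) ->
  pi (`[0, 1] `*` setT) = 1%E.
Proof. by move=> ->. Qed.

Lemma transcriptP pi : is_transcript P pi <->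
  [/\ (forall A, measurable A -> pi (A `*` setT) = P A),
      pi (setT `*` `[0, 1]) = 1%E &
      forall B, measurable B -> mean pi (fun z => \1_B z.2 * clamp z.1) =
                                mean pi (fun z => \1_B z.2 * clamp z.2)].
Proof.
have mX1 : measurable (`[0, 1] `*` setT : set (R * R)) by exact: measurableX.
have mX2 : measurable (setT `*` `[0, 1] : set (R * R)) by exact: measurableX.
have E1 : (forall A, measurable A -> pi (A `*` setT) = P A) -> forall B, measurable B ->
    (\int[pi]_(z in setT `*` B) (z.1)%:E = (mean pi (fun z => \1_B z.2 * clamp z.1))%:E)%E.
  move=> H1 B mB; apply: integral_slice mX1 _ m1 c1 _ => //; first exact: ability01.
  by move=> z [/= z01 _]; rewrite clamp_id//; rewrite in_itv in z01.
have E2 : pi (setT `*` `[0, 1]) = 1%E -> forall B, measurable B ->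
    (\int[pi]_(z in setT `*` B) (z.2)%:E = (mean pi (fun z => \1_B z.2 * clamp z.2))%:E)%E.
  move=> H2 B mB; apply: integral_slice mX2 H2 m2 c2 _ => //.
  by move=> z [/= _ z01]; rewrite clamp_id//; rewrite in_itv in z01.
split=> [[H1 [H2 H3]]|[H1 H2 H3]]; split => //.
  by move=> B mB; apply: EFin_inj; rewrite -E1// -E2// H3.
by split => // B mB; rewrite E1// E2// H3.
Qed.

Section Deviation.
Local Open Scope classical_set_scope.
Variables (pi : probability (R * R)%type R) (B : set R) (y rho : R).
Hypotheses (tr : is_transcript P pi) (mB : measurable B).
Hypotheses (y01 : 0 <= y <= 1) (rho01 : 0 <= rho <= 1).
Let hi := \1_(`]y, +oo[) : R -> R.
Let bhi : bounded_mfun (fun z : R * R => hi z.1) := bm_ind m1 (measurable_itv _).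
Let bB : bounded_mfun (fun z : R * R => \1_B z.2 : R) := bm_ind m2 mB.
(** The pool consists of the abilities above [y] and a share [rho] of the others; surplus equal to
    deficit means that its average is [y]. *)
Hypothesis balance : mean pi (fun z => \1_B z.2 * (hi z.1 * (clamp z.1 - y))) =
  rho * mean pi (fun z => \1_B z.2 * ((1 - hi z.1) * (y - clamp z.1))).

(* On labels in [B], [T1] pools everyone at [y], and [T2] gives label [y] to the
   abilities above [y] and reveals the others. The deviation applies [T1] with
   probability [rho] and [T2] otherwise. *)
Let T1 (z : R * R) := (z.1, \1_B z.2 * y + (1 - \1_B z.2) * z.2).
Let T2 (z : R * R) := (z.1, \1_B z.2 * Num.min z.1 y + (1 - \1_B z.2) * z.2).

Let mT1 : measurable_fun setT T1.
Proof.
apply: measurable_fun_pair => //; apply: measurable_funD; apply: measurable_funM => //.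
- exact: bB.1.
- by apply: measurable_funB => //; exact: bB.1.
Qed.

Let mT2 : measurable_fun setT T2.
Proof.
apply: measurable_fun_pair => //; apply: measurable_funD; apply: measurable_funM => //.
- exact: bB.1.
- exact: measurable_minr.
- by apply: measurable_funB => //; exact: bB.1.
Qed.

Let hiE (a : R) : hi a = (y < a)%R%:R.
Proof. by rewrite /hi indicE mem_setE in_itv /= andbT. Qed.

Let label_mix (f : R -> R) (z : R * R) :
  rho * f (T1 z).2 + (1 - rho) * f (T2 z).2 =
  (1 - \1_B z.2) * f z.2 + \1_B z.2 * (rho * f y
        + (1 - rho) * (hi z.1 * f y + (1 - hi z.1) * f z.1)).
Proof.
rewrite /T1 /T2 /= hiE !indicE.
have [zB|zB] := boolP (z.2 \in B); rewrite /= ?mul1r ?mul0r ?subr0 ?subrr ?mul0r ?mul1r ?addr0 ?add0r; last by ring.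
case: (ltP y z.1) => yz /=; ring.
Qed.

(** Labels outside [B] keep their calibration defect and a revealed student has none. All the new
    defect therefore sits at label [y], where [balance] gives it mean zero. *)
Let martingale_mix (B' : set R) (z : R * R) :
  rho * (\1_B' (T1 z).2 * clamp (T1 z).1 - \1_B' (T1 z).2 * clamp (T1 z).2)
  + (1 - rho) * (\1_B' (T2 z).2 * clamp (T2 z).1 - \1_B' (T2 z).2 * clamp (T2 z).2)
  = (\1_(B' `\` B) z.2 * clamp z.1 - \1_(B' `\` B) z.2 * clamp z.2)
     + \1_B' y * (\1_B z.2 * (hi z.1 * (clamp z.1 - y))
     - rho * (\1_B z.2 * ((1 - hi z.1) * (y - clamp z.1)))).
Proof.
rewrite /T1 /T2 /= hiE !indicE in_setD.
have [zB|zB] := boolP (z.2 \in B); rewrite /= ?andbT ?andbF ?mul1r ?mul0r ?subr0 ?subrr ?mul0r ?mul1r ?addr0 ?add0r; last first.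
  by rewrite ?mul0r; ring.
rewrite (clamp_id y01); case: (ltP y z.1) => yz /=.
  by rewrite (clamp_id y01); ring.
by ring.
Qed.

Let mix_exists : exists M : probability (R * R)%type R,
  (forall A : set (R * R), measurable A ->
     M A = (rho%:E * pi (T1 @^-1` A) + (1 - rho)%:E * pi (T2 @^-1` A))%E) /\
  (forall f, bounded_mfun f -> mean M f =
     mean pi (fun z => rho * f (T1 z) + (1 - rho) * f (T2 z))).
Proof.
have [Q1 [Q1A Q1m]] := pushforward_exists pi mT1.
have [Q2 [Q2A Q2m]] := pushforward_exists pi mT2.
pose w (i : 'I_2) := if i == 0 then rho else 1 - rho.
pose Q (i : 'I_2) := if i == 0 then Q1 else Q2.
case/andP: rho01 => r0 r1.
have [|| M [MA Mm]] := @mixture_exists _ _ _ 2 w Q.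
- by move=> i; rewrite /w; case: ifP => // _; rewrite subr_ge0.
- by rewrite !big_ord_recl big_ord0 /w /= addr0 addrC subrK.
exists M; split.
  by move=> A mA; rewrite MA// !big_ord_recl big_ord0 /w /Q /= adde0 Q1A Q2A.
move=> f bf; rewrite Mm// !big_ord_recl big_ord0 /w /Q /= addr0 Q1m// Q2m//.
have b1 := bm_comp mT1 bf; have b2 := bm_comp mT2 bf.
by rewrite meanD ?meanZ//; apply: bmM => //; exact: bm_cst.
Qed.

Let labels_full (A : set (R * R)) : measurable A ->
  (forall z, 0 <= z.1 <= 1 -> 0 <= z.2 <= 1 -> A z) -> pi A = 1%E.
Proof.
move=> mA HA; have /transcriptP[H1 H2 _] := tr.
have mX1 : measurable (`[0, 1] `*` setT : set (R * R)) by exact: measurableX.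
have mX2 : measurable (setT `*` `[0, 1] : set (R * R)) by exact: measurableX.
have Z1 : pi (~` (`[0, 1] `*` setT)) = 0%E.
  by rewrite probability_setC// ability01// subee.
have Z2 : pi (~` (setT `*` `[0, 1])) = 0%E.
  by rewrite probability_setC// H2 subee.
have Z : pi (~` A) = 0%E.
  apply/eqP; rewrite eq_le measure_ge0 andbT.
  apply: (@le_trans _ _ (pi (~` (`[0%R, 1%R] `*` setT)) + pi (~` (setT `*` `[0%R, 1%R])))%E).
    apply: le_trans (measureU2 pi (measurableC mX1) (measurableC mX2)).
    apply: le_measure; rewrite ?inE; [exact: measurableC|by apply: measurableU; exact: measurableC|].
    rewrite -setCI; apply: subsetC => z [[/= + _] [_ /=]]; rewrite !in_itv /=.
    exact: HA.
  by rewrite Z1 Z2 adde0.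
have := probability_setC pi (measurableC mA).
by rewrite setCK Z sube0.
Qed.

Lemma deviation_exists : exists pi' : probability (R * R)%type R,
  is_transcript P pi' /\
  forall f : R -> R, bounded_mfun f ->
    mean pi' (fun z => f z.2) = mean pi (fun z =>
      (1 - \1_B z.2) * f z.2 + \1_B z.2 * (rho * f y
        + (1 - rho) * (hi z.1 * f y + (1 - hi z.1) * f z.1))).
Proof.
have /transcriptP[H1 H2 H3] := tr.
have [M [MA Mm]] := mix_exists.
have mix1 (a b : \bar R) : a = b -> b \is a fin_num ->
   (rho%:E * a + (1 - rho)%:E * b = b)%E.
  by move=> -> /fineK <-; rewrite -!EFinM -EFinD; congr EFin; ring.
exists M; split; last first.
  move=> f bf; rewrite (Mm (fun z => f z.2)); last exact: (bm_comp m2 bf).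
  by under eq_fun do rewrite label_mix.
apply/transcriptP; split.
- move=> A mA; have mAT : measurable (A `*` setT : set (R * R)) by exact: measurableX.
  have E1 : T1 @^-1` (A `*` setT) = A `*` setT by [].
  have E2 : T2 @^-1` (A `*` setT) = A `*` setT by [].
  by rewrite MA// E1 E2 mix1 ?fin_num_measure// H1.
- have mX2 : measurable (setT `*` `[0, 1] : set (R * R)) by exact: measurableX.
  case/andP: (y01) => y0 y1.
  have F1 : pi (T1 @^-1` (setT `*` `[0, 1])) = 1%E.
    apply: labels_full; first by rewrite -[X in measurable X]setTI; exact: mT1.
    move=> z _ /andP[x0 x1]; split => //=; rewrite in_itv /= indicE.
    case: (z.2 \in B) => /=; rewrite ?mul1r ?mul0r ?subr0 ?subrr ?mul0r ?mul1r ?addr0 ?add0r.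
      by rewrite y0 y1.
    by rewrite x0 x1.
  have F2 : pi (T2 @^-1` (setT `*` `[0, 1])) = 1%E.
    apply: labels_full; first by rewrite -[X in measurable X]setTI; exact: mT2.
    move=> z /andP[a0 a1] /andP[x0 x1]; split => //=; rewrite in_itv /= indicE.
    case: (z.2 \in B) => /=; rewrite ?mul1r ?mul0r ?subr0 ?subrr ?mul0r ?mul1r ?addr0 ?add0r.
      by rewrite le_min a0 y0 /= ge_min a1.
    by rewrite x0 x1.
  by rewrite MA// F1 F2 mix1.
- move=> B' mB'.
  have bB' : bounded_mfun (fun z : R * R => \1_B' z.2 : R) := bm_ind m2 mB'.
  apply/eqP; rewrite -subr_eq0 -meanB; [|exact: bmM|exact: bmM].
  rewrite Mm; last by apply: bmB; exact: bmM.
  pose B'' := B' `\` B; have mB'' : measurable B'' by exact: measurableD.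
  have bB'' : bounded_mfun (fun z : R * R => \1_B'' z.2 : R) := bm_ind m2 mB''.
  under eq_fun do rewrite martingale_mix.
  have b1 : bounded_mfun (fun z : R * R => \1_B z.2 * (hi z.1 * (clamp z.1 - y))) by bm_tac.
  have b2 : bounded_mfun (fun z : R * R => \1_B z.2 * ((1 - hi z.1) * (y - clamp z.1))) by bm_tac.
  rewrite meanD; try by bm_tac.
  rewrite meanZ; last by bm_tac.
  rewrite meanB; try by bm_tac.
  rewrite meanB; try by bm_tac.
  by rewrite meanZ// balance subrr mulr0 addr0 H3// subrr.
Qed.

End Deviation.
End Transcripts.

(** * Consequences of the optimality of one school's transcript *)

Section BestResponse.
Local Open Scope classical_set_scope.
Context {R : realType}.
Variables (P : probability R R) (pi : probability (R * R)%type R) (V : R -> R).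
Hypotheses (P01 : P `[0, 1] = 1%E) (tr : is_transcript P pi).
Hypotheses (bV : bounded_mfun V) (V0 : forall x, 0 <= V x).
Hypothesis best : forall pi' : probability (R * R)%type R, is_transcript P pi' ->
  mean pi' (fun z => V z.2) <= mean pi (fun z => V z.2).

Notation above y := (\1_(`]y, +oo[) : R -> R).

Let m1 : measurable_fun setT (fun z : R * R => z.1) := measurable_fst.
Let m2 : measurable_fun setT (fun z : R * R => z.2) := measurable_snd.
Let c1 := bm_clamp m1.
Let c2 := bm_clamp m2.
Let bA y : bounded_mfun (fun z : R * R => above y z.1) := bm_ind m1 (measurable_itv _).
Let bV2 : bounded_mfun (fun z : R * R => V z.2) := bm_comp m2 bV.

Let aboveE y (a : R) : above y a = (y < a)%R%:R.
Proof. by rewrite indicE mem_setE in_itv /= andbT. Qed.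

Let above_clamp y (a : R) : 0 <= y <= 1 ->
  0 <= above y a * (clamp a - y) /\ 0 <= (1 - above y a) * (y - clamp a).
Proof.
move=> y01; rewrite aboveE -(clamp_id y01).
case: (ltP (clamp y) a) => h /=; rewrite ?mul1r ?mul0r ?subrr ?subr0 ?mul0r ?mul1r ?subr_ge0; split => //.
  rewrite clamp_id// in h *; rewrite -{1}(clamp_id y01); exact/clamp_nondecreasing/ltW.
rewrite clamp_id// in h *; rewrite -(clamp_id y01); exact: clamp_nondecreasing.
Qed.

(** The two expressions are the positive and negative parts of [clamp a - y], hence 1-Lipschitz in
    [y]. *)
Let above_shift y t a : 0 < t -> 0 <= y <= 1 -> 0 <= y + t <= 1 ->
  above y a * (clamp a - y) - t <= above (y + t) a * (clamp a - (y + t)) /\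
  (1 - above (y + t) a) * (y + t - clamp a) <= (1 - above y a) * (y - clamp a) + t.
Proof.
move=> t0 y01 yt01; have [h1 h2] := above_clamp a yt01; have [h3 h4] := above_clamp a y01.
rewrite !aboveE in h1 h2 h3 h4 *; move: (clamp a) h1 h2 h3 h4 => c.
by case: ltP => _; case: ltP => _; rewrite ?mul1r ?mul0r ?subrr ?subr0 ?mul0r ?mul1r; lra.
Qed.

(** A pointwise Markov inequality: the right side is [b] times the distance from [clamp a] to [y],
    and the subtracted indicators excuse abilities near [y] or outside [0, 1]. *)
Let near_atom y t (b : bool) a : 0 < t -> 0 <= y <= 1 ->
  t * (b%:R - \1_(`](y - t), (y + t)[) a - \1_(~` `[0, 1]) a) <=
  b%:R * (above y a * (clamp a - y)) + b%:R * ((1 - above y a) * (y - clamp a)).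
Proof.
move=> t0 y01; have [h1 h2] := above_clamp a y01.
rewrite !aboveE in h1 h2 *; rewrite !indicE in_setC !mem_setE !in_itv /=.
have i0 : 0 <= t * (y - t < a < y + t)%R%:R by apply: mulr_ge0 => //; exact: ltW.
have o0 : 0 <= t * (~~ (0 <= a <= 1))%:R by apply: mulr_ge0 => //; exact: ltW.
case: b => /=; rewrite ?mul1r ?mul0r; last first.
  move: i0 o0; move: (_%:R) => i; move: ((~~ _)%:R) => o i0 o0; lra.
move: o0; case: (boolP (0 <= a <= 1)) => [a01|_] /= o0; last by lra.
rewrite clamp_id// in h1 h2 *.
case: (boolP (y - t < a < y + t)) => [_|] /=; first by rewrite subrr; lra.
rewrite negb_and -!leNgt; case: (ltP y a) => ya /= /orP[h|h]; lra.
Qed.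

(** Payoffs outside [B] are unchanged and cancel; the payoff of the students revealed by the
    deviation is dropped, being nonnegative. *)
Lemma deviation_le (B : set R) (y rho : R) : measurable B -> 0 <= y <= 1 ->
  0 <= rho <= 1 ->
  mean pi (fun z => \1_B z.2 * (above y z.1 * (clamp z.1 - y))) =
    rho * mean pi (fun z => \1_B z.2 * ((1 - above y z.1) * (y - clamp z.1))) ->
  V y * mean pi (fun z => \1_B z.2 * (above y z.1 + rho * (1 - above y z.1)))
    <= mean pi (fun z => \1_B z.2 * V z.2).
Proof.
move=> mB y01 rho01 bal; have bB := bm_ind m2 mB.
have [pi' [tr' E]] := deviation_exists P01 tr mB y01 rho01 bal.
have := best tr'; rewrite (E _ bV).
have bV1 : bounded_mfun (fun z : R * R => V z.1) := bm_comp m1 bV.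
case/andP: rho01 => r0 r1.
have : mean pi (fun z => (1 - \1_B z.2) * V z.2
    + V y * (\1_B z.2 * (above y z.1 + rho * (1 - above y z.1)))) <=
  mean pi (fun z => (1 - \1_B z.2) * V z.2 + \1_B z.2 * (rho * V y
    + (1 - rho) * (above y z.1 * V y + (1 - above y z.1) * V z.1))).
  have bAy := bA y.
  apply: mean_le; [by bm_tac|by bm_tac|move=> z].
  rewrite lerD2l !indicE; case: (z.2 \in B); rewrite ?mul1r ?mul0r ?mulr0//.
  have := V0 z.1; have := V0 y; case: (z.1 \in _) => /=; rewrite ?subrr ?subr0; nra.
move=> /le_trans h /h {h}.
have bAy := bA y.
rewrite meanD; try by bm_tac.
rewrite meanZ; last by bm_tac.
have -> : mean pi (fun z => V z.2) = mean pi (fun z => (1 - \1_B z.2) * V z.2 + \1_B z.2 * V z.2).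
  by congr (mean pi _); apply/funext => z; ring.
rewrite meanD; try by bm_tac.
by rewrite lerD2l.
Qed.

Let shift (B : set R) (y : R) : measurable B ->
  mean pi (fun z => \1_B z.2 * (above y z.1 * (clamp z.1 - y)))
  - mean pi (fun z => \1_B z.2 * ((1 - above y z.1) * (y - clamp z.1)))
  = mean pi (fun z => \1_B z.2 * (clamp z.2 - y)).
Proof.
move=> mB; have bB := bm_ind m2 mB; have bAy := bA y.
have /(transcriptP P01)[_ _ H] := tr.
rewrite -meanB; try by bm_tac.
rewrite (_ : (fun z => _) = (fun z => \1_B z.2 * clamp z.1 - y * \1_B z.2)); last first.
  by apply/funext => z; ring.
rewrite meanB; try by bm_tac.
rewrite H// -meanB; try by bm_tac.
by congr (mean pi _); apply/funext => z; ring.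
Qed.

(** By [shift] the surplus above [y] is at most the deficit below it, so [rho] is their ratio. *)
Let balance_exists (B : set R) (y : R) : measurable B -> 0 <= y <= 1 ->
  mean pi (fun z => \1_B z.2 * (clamp z.2 - y)) <= 0 ->
  exists2 rho, 0 <= rho <= 1 &
  mean pi (fun z => \1_B z.2 * (above y z.1 * (clamp z.1 - y))) =
    rho * mean pi (fun z => \1_B z.2 * ((1 - above y z.1) * (y - clamp z.1))).
Proof.
move=> mB y01; rewrite -shift//.
set p := mean pi _; set m := mean pi _ => pm.
have p0 : 0 <= p.
  apply: mean_ge0 => z; apply: mulr_ge0; first by rewrite indicE.
  exact: (above_clamp _ y01).1.
(* Here surplus and deficit both vanish, and any share would balance. *)
have [m0|m0] := leP m 0.
  by exists 1; [rewrite ler01 lexx|lra].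
exists (p / m); last by rewrite divfK// gt_eqF.
by rewrite divr_ge0 ?(ltW m0)//= ler_pdivrMr// mul1r; lra.
Qed.

(** The pool has average [y], so [y] times its mass is its total ability, of which the part above
    [y] is a lower bound. *)
Lemma pooling_le (B : set R) (y : R) : measurable B -> 0 <= y <= 1 ->
  (forall x, B x -> x <= y) ->
  V y * mean pi (fun z => \1_B z.2 * (above y z.1 * clamp z.1))
    <= y * mean pi (fun z => \1_B z.2 * V z.2).
Proof.
move=> mB y01 By; have bB := bm_ind m2 mB; have bAy := bA y.
have neg : mean pi (fun z => \1_B z.2 * (clamp z.2 - y)) <= 0.
  rewrite -(mean_cst pi 0); apply: mean_le; [by bm_tac|by bm_tac|move=> z].
  rewrite indicE; case: (boolP (z.2 \in B)) => [|_]; rewrite ?mul0r//.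
  rewrite inE => /By zy; rewrite mul1r subr_le0 -[leRHS](clamp_id y01).
  exact: clamp_nondecreasing.
have [rho rho01 bal] := balance_exists mB y01 neg.
have D := deviation_le mB y01 rho01 bal.
case/andP: (y01) => y0 y1; case/andP: rho01 => r0 r1.
apply: le_trans (ler_wpM2l y0 D).
rewrite mulrCA; apply: ler_wpM2l => //.
rewrite -meanZ; last by bm_tac.
have : 0 <= rho * mean pi (fun z => \1_B z.2 * ((1 - above y z.1) * clamp z.1)).
  apply: mulr_ge0 => //; apply: mean_ge0 => z; rewrite !indicE.
  have /andP[c0 _] := clamp_itv z.1.
  by case: (z.2 \in B); case: (z.1 \in _); rewrite ?mul1r ?mul0r ?subrr ?subr0 ?mul0r ?mul1r.
have : mean pi (fun z => y * (\1_B z.2 * (above y z.1 + rho * (1 - above y z.1)))) =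
  mean pi (fun z => \1_B z.2 * (above y z.1 * clamp z.1))
  + rho * mean pi (fun z => \1_B z.2 * ((1 - above y z.1) * clamp z.1))
  - (mean pi (fun z => \1_B z.2 * (above y z.1 * (clamp z.1 - y)))
  - rho * mean pi (fun z => \1_B z.2 * ((1 - above y z.1) * (y - clamp z.1)))).
  rewrite -!meanZ; try by bm_tac.
  rewrite -!meanB; try by bm_tac.
  rewrite -!meanD; try by bm_tac.
  rewrite -!meanB; try by bm_tac.
  by congr (mean pi _); apply/funext => z; ring.
rewrite bal; lra.
Qed.

(* Pooling the atom with label [y + t], for small [t], shows that no student
   labelled [y] is above [y], so that all of them have ability exactly [y]; but
   abilities have no atom. *)
Lemma no_label_atom (y r K : R) : 0 <= y <= 1 -> 0 <= r < 1 -> 0 <= K ->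
  (forall e, 0 < e -> (P `](y - e)%R, (y + e)%R[ <= (K * e)%:E)%E) ->
  (forall y', y < y' <= 1 -> 0 < V y' /\ V y <= r * V y') ->
  pi (setT `*` [set y]) = 0%E.
Proof.
move=> y01 /andP[r0 r1] K0 Pdens Vjump.
have /(transcriptP P01)[H1 _ _] := tr.
pose B := [set y]; have mB : measurable B by exact: measurable_set1.
have bB := bm_ind m2 mB; have bAy := bA.
have mX : measurable (setT `*` B : set (R * R)) by exact: measurableX.
pose p := mean pi (fun z => \1_B z.2).
have pE : p%:E = pi (setT `*` B).
  rewrite -mean_indic//; congr (_%:E); congr (mean pi _); apply/funext => z.
  rewrite !indicE; suff -> : (z.2 \in B) = (z \in setT `*` B) by [].
  by apply/idP/idP; rewrite !inE //= => -[].
have p0 : 0 <= p by apply: mean_ge0 => z; rewrite indicE.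
have p1 : p <= 1.
  rewrite -(mean_cst pi 1); apply: mean_le; [by []|by bm_tac|move=> z].
  by rewrite indicE lern1 leq_b1.
rewrite -pE; congr (_%:E); apply/eqP; rewrite eq_le p0 andbT.
rewrite leNgt; apply/negP => pp.
pose e := mean pi (fun z => \1_B z.2 * (above y z.1 * (clamp z.1 - y))).
have e0 : 0 <= e.
  apply: mean_ge0 => z; apply: mulr_ge0; first by rewrite indicE.
  exact: (above_clamp _ y01).1.
have on_atom c : mean pi (fun z => \1_B z.2 * (clamp z.2 - c)) = (y - c) * p.
  rewrite /p -meanZ//; congr (mean pi _); apply/funext => z; rewrite indicE.
  case: (boolP (z.2 \in B)) => [|_]; rewrite ?mul0r ?mulr0//.
  by rewrite inE => ->; rewrite mul1r mulr1 clamp_id.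
have eE : mean pi (fun z => \1_B z.2 * ((1 - above y z.1) * (y - clamp z.1))) = e.
  by have := shift y mB; rewrite on_atom subrr mul0r -/e; lra.
(* Pooling at [y' = y + t] rewards a share at least [rho] of the atom with [V y'], so [rho <= r].
   Since [e] moves by at most [t], balance gives [e - t <= r * (e + t)]. *)
have small t : 0 < t -> y + t <= 1 -> (1 - r) * e <= 2 * t.
  move=> t0 yt; set y' := y + t.
  have yy' : y < y' <= 1 by rewrite /y' yt andbT; lra.
  have y'01 : 0 <= y' <= 1 by case/andP: y01 => y0 _; rewrite yt andbT /y'; lra.
  have [V'0 Vle] := Vjump _ yy'.
  have neg : mean pi (fun z => \1_B z.2 * (clamp z.2 - y')) <= 0.
    by rewrite on_atom /y'; nra.
  have [rho rho01 bal] := balance_exists mB y'01 neg.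
  have D := deviation_le mB y'01 rho01 bal.
  case/andP: (rho01) => q0 q1.
  have lo : rho * p <= mean pi (fun z => \1_B z.2 * (above y' z.1 + rho * (1 - above y' z.1))).
    rewrite /p -meanZ//; apply: mean_le; [by bm_tac|by bm_tac|move=> z].
    rewrite mulrC ler_wpM2l// !indicE; case: (z.1 \in _); rewrite ?subrr ?subr0.
      by rewrite mulr0 addr0.
    by rewrite mulr1 add0r.
  have VB : mean pi (fun z => \1_B z.2 * V z.2) = V y * p.
    rewrite /p -meanZ//; congr (mean pi _); apply/funext => z; rewrite indicE.
    case: (boolP (z.2 \in B)) => [|_]; rewrite ?mul0r ?mulr0//.
    by rewrite inE => ->; rewrite mul1r mulr1.
  have rr : rho <= r.
    have : V y' * (rho * p) <= V y * p.
      by rewrite -VB; apply: le_trans D; apply: ler_wpM2l => //; exact: ltW.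
    move=> h; have {}h : (V y' * p) * rho <= (V y' * p) * r.
      apply: le_trans (_ : r * V y' * p <= _); last by lra.
      by apply: le_trans (_ : V y * p <= _); [lra|apply: ler_wpM2r].
    by rewrite -(ler_pM2l (mulr_gt0 V'0 pp)).
  have pe : e - t <= mean pi (fun z => \1_B z.2 * (above y' z.1 * (clamp z.1 - y'))).
    rewrite -(mean_cst pi t) -meanB; try by bm_tac.
    apply: mean_le; [by bm_tac|by bm_tac|move=> z].
    rewrite indicE; case: (z.2 \in B); rewrite ?mul1r ?mul0r.
      exact: (above_shift z.1 t0 y01 y'01).1.
    by rewrite sub0r oppr_le0 ltW.
  have me : mean pi (fun z => \1_B z.2 * ((1 - above y' z.1) * (y' - clamp z.1))) <= e + t.
    rewrite -eE -(mean_cst pi t) -meanD; try by bm_tac.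
    apply: mean_le; [by bm_tac|by bm_tac|move=> z].
    rewrite indicE; case: (z.2 \in B); rewrite ?mul1r ?mul0r.
      exact: (above_shift z.1 t0 y01 y'01).2.
    by rewrite add0r ltW.
  rewrite bal in pe.
  have : rho * mean pi (fun z => \1_B z.2 * ((1 - above y' z.1) * (y' - clamp z.1))) <= r * (e + t).
    apply: ler_pM => //; apply: mean_ge0 => z; apply: mulr_ge0; first by rewrite indicE.
    exact: (above_clamp _ y'01).2.
  nra.
have e00 : e = 0.
  apply/eqP; rewrite eq_le e0 andbT leNgt; apply/negP => ep.
  (* At [y = 1] no larger label is available, but then no clamped ability exceeds [y]. *)
  case/andP: (y01) => y0; rewrite le_eqVlt => /predU1P[y1|y1].
    move: ep; apply/negP; rewrite -leNgt -(mean_cst pi 0); apply: mean_le; [by bm_tac|by bm_tac|move=> z].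
    have /andP[_ h] := clamp_itv z.1.
    rewrite !indicE; case: (z.2 \in B); case: (z.1 \in _) => /=; rewrite ?mul1r ?mul0r//; lra.
  pose t := Num.min (1 - y) ((1 - r) * e / 4).
  have t0 : 0 < t by rewrite lt_min subr_gt0 y1 /= divr_gt0// mulr_gt0// subr_gt0.
  have tl : t <= 1 - y by rewrite ge_min lexx.
  have tr' : t <= (1 - r) * e / 4 by rewrite ge_min lexx orbT.
  have := small t t0; have : 0 < (1 - r) * e by rewrite mulr_gt0// subr_gt0.
  lra.
(* Surplus and deficit of the atom vanish, so [near_atom] places all its mass within [t] of [y]. *)
have bound t : 0 < t -> p <= K * t.
  move=> t0; pose I : set R := `](y - t)%R, (y + t)%R[; pose O : set R := ~` `[0, 1].
  have mO : measurable O by exact: measurableC.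
  have bI : bounded_mfun (fun z : R * R => \1_I z.1 : R).
    by apply: bm_ind => //; exact: measurable_itv.
  have bO : bounded_mfun (fun z : R * R => \1_O z.1 : R).
    by apply: bm_ind => //; apply: measurableC; exact: measurable_itv.
  have meanP A : measurable A -> (mean pi (fun z => \1_A z.1))%:E = P A.
    move=> mA; have mAX : measurable (A `*` setT : set (R * R)) by exact: measurableX.
    rewrite -H1// -mean_indic//; congr (_%:E); congr (mean pi _); apply/funext => z.
    rewrite !indicE; suff -> : (z.1 \in A) = (z \in A `*` setT) by [].
    by apply/idP/idP; rewrite !inE //= => -[].
  have O0 : mean pi (fun z => \1_O z.1) = 0.
    by apply: EFin_inj; rewrite meanP// /O probability_setC// P01 subee.
  have I0 : mean pi (fun z => \1_I z.1) <= K * t.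
    by rewrite -lee_fin meanP; [exact: Pdens|exact: measurable_itv].
  have : t * (p - mean pi (fun z => \1_I z.1) - mean pi (fun z => \1_O z.1)) <= e + e.
    rewrite -{2}eE -!meanB -?meanZ -?meanD; try by bm_tac.
    apply: mean_le; [by bm_tac|by bm_tac|move=> z].
    by rewrite [\1_B _]indicE; exact: near_atom.
  rewrite e00 O0 subr0 addr0 => h.
  have : p - mean pi (fun z => \1_I z.1) <= 0 by rewrite -(pmulr_rle0 _ t0).
  lra.
have [K00|K00] := eqVneq K 0; first by have := bound 1 ltr01; rewrite K00; lra.
have Kp : 0 < K by rewrite lt_neqAle eq_sym K00.
(* This radius gives [p <= p / 2], contradicting [0 < p]. *)
have := bound (p / (2 * K)).
rewrite divr_gt0// ?mulr_gt0// => /(_ isT).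
have -> : K * (p / (2 * K)) = p / 2 by field.
lra.
Qed.

End BestResponse.

(** * Equilibrium label law *)

Section Equilibrium.
Local Open Scope classical_set_scope.
Context {R : realType}.
Notation mu := (@lebesgue_measure R).
Variables (dens : R -> R) (n : nat) (w : 'I_n -> R) (F : 'I_n -> probability R R)
  (pi : 'I_n -> probability (R * R)%type R).
Hypotheses (jd : is_job_density dens) (sch : school_types w F)
  (eqm : is_equilibrium dens w F pi).

Let w0 i : 0 < w i := sch.1 i.
Let tr i : is_transcript (F i) (pi i) := eqm.1 i.
Let J := job_prob jd.
Let J01 : J `[0, 1] = 1%E := job_prob_itv01 jd.
Let Q := total_quantile J.
Let ndQ : nondecreasing_fun Q := total_quantile_nondecreasing J01.
Let Q01 t : 0 <= Q t <= 1 := total_quantile_itv J01 t.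
Let lQ : lbm Q := lbm_nondecreasing ndQ.
Let m1 : measurable_fun setT (fun z : R * R => z.1) := measurable_fst.
Let m2 : measurable_fun setT (fun z : R * R => z.2) := measurable_snd.

Let bclamp : bounded_mfun (@clamp R).
Proof.
split; first exact: measurable_clamp.
by exists 1 => a; have /andP[c0 c1] := clamp_itv a; rewrite ger0_norm.
Qed.

(** The other types contribute nonnegatively to the uniform aggregate; hence each type lives on
    [0, 1] with density at most [1 / w i]. *)
Let school_le i (A : set R) : measurable A ->
  ((w i)%:E * F i A <= mu (A `&` `[0%R, 1%R]))%E.
Proof.
move=> mA; rewrite -sch.2.2// (bigD1 i)//= leeDl// sume_ge0// => j _.
by rewrite mule_ge0// lee_fin ltW.
Qed.

Let F01 i : F i `[0, 1] = 1%E.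
Proof.
have mC : measurable (~` `[0, 1] : set R) by apply: measurableC; exact: measurable_itv.
have := school_le i mC; rewrite setICl measure0.
have -> : F i (~` `[0, 1]) = (1 - F i `[0%R, 1%R])%E by apply: probability_setC.
have fF : F i `[0, 1] \is a fin_num by rewrite fin_num_measure//; exact: measurable_itv.
rewrite -(fineK fF).
have : fine (F i `[0, 1]) <= 1.
  by rewrite -lee_fin fineK//; exact: probability_le1.
move: (fine _) => f f1; rewrite -EFinB -EFinM lee_fin pmulr_rle0// => h.
by congr (_%:E); lra.
Qed.

Let F_dens i (y e : R) : 0 < e ->
  (F i `](y - e)%R, (y + e)%R[ <= (2 / w i * e)%:E)%E.
Proof.
move=> e0; have mI : measurable (`](y - e), (y + e)[ : set R) by exact: measurable_itv.
have := le_trans (school_le i mI) (_ : _ <= mu `](y - e)%R, (y + e)%R[)%E.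
have fI : F i `](y - e)%R, (y + e)%R[ \is a fin_num by rewrite fin_num_measure.
rewrite -(fineK fI).
move=> H; rewrite lee_fin mulrAC ler_pdivlMr// mulrC -lee_fin EFinM.
apply: le_trans (H _) _.
  by apply: le_measure; rewrite ?inE//; exact: measurableI.
rewrite lebesgue_measure_itv /= lte_fin.
have -> : y - e < y + e by lra.
by rewrite -EFinD lee_fin; lra.
Qed.

Let mean_aggregate (M : probability (R * R)%type R)
  (Mm : forall f, bounded_mfun f -> mean M f = \sum_(i < n) w i * mean (pi i) f)
  (B : set R) : measurable B ->
  mean M (fun z => \1_B z.2 * clamp z.1) = mean M (fun z => \1_B z.2 * clamp z.2).
Proof.
move=> mB; have bB := bm_ind m2 mB; have c1 := bm_clamp m1; have c2 := bm_clamp m2.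
rewrite !Mm; try by bm_tac.
apply: eq_bigr => i _; congr (_ * _).
by have /(transcriptP (F01 i))[_ _ ->] := tr i.
Qed.

(** [M] is the joint law of ability and label in the whole population and [G] its label marginal.
    The ability marginal is uniform, hence its own quantile is the rank itself. *)
Lemma label_law_exists : exists2 G : probability R R, G `[0, 1] = 1%E &
  (forall A, measurable A -> agg_labels w pi A = G A) /\
  exists M : probability (R * R)%type R,
   [/\ (forall f, bounded_mfun f -> mean M f = \sum_(i < n) w i * mean (pi i) f),
       (forall f : R -> R, bounded_mfun f -> (forall x, 0 <= f x) ->
          mean M (fun z => f z.2) = itvint 0 1 (fun t => f (total_quantile G t))) &
       (forall f : R -> R, bounded_mfun f -> (forall x, 0 <= f x) ->
          mean M (fun z => f z.1) = itvint 0 1 f)].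
Proof.
have [M [MA Mm]] := mixture_exists pi (fun i => ltW (w0 i)) sch.2.1.
have [G [GA Gm]] := pushforward_exists M m2.
have [H [HA Hm]] := pushforward_exists M m1.
have mXr (A : set R) : measurable A -> measurable (setT `*` A : set (R * R)).
  by move=> mA; exact: measurableX.
have mXl (A : set R) : measurable A -> measurable (A `*` setT : set (R * R)).
  by move=> mA; exact: measurableX.
have GE A : measurable A -> G A = agg_labels w pi A.
  move=> mA; rewrite GA; have -> : (fun z : R * R => z.2) @^-1` A = setT `*` A.
    by rewrite eqEsubset; split => z //= -[].
  by rewrite MA//; exact: mXr.
have HE A : measurable A -> H A = mu (A `&` `[0, 1]).
  move=> mA; rewrite HA; have -> : (fun z : R * R => z.1) @^-1` A = A `*` setT.
    by rewrite eqEsubset; split => z //= -[].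
  rewrite MA; last exact: mXl.
  rewrite -sch.2.2//; apply: eq_bigr => i _.
  by have /(transcriptP (F01 i))[->] := tr i.
have G01 : G `[0, 1] = 1%E.
  rewrite GE; last exact: measurable_itv.
  rewrite /agg_labels (eq_bigr (fun i => (w i)%:E)); first by rewrite sumEFin sch.2.1.
  by move=> i _; have /(transcriptP (F01 i))[_ -> _] := tr i; rewrite mule1.
have H01 : H `[0, 1] = 1%E.
  rewrite HE; last exact: measurable_itv.
  by rewrite setIid lebesgue_measure_itv /= lte01 sube0.
exists G => //; split; first by move=> A mA; rewrite GE.
exists M; split => //.
  move=> f bf f0; rewrite -Gm// /mean /itvint /Rintegral; congr fine.
  by rewrite (ge0_integral_quantile G01)//; apply/measurable_EFinP; exact: bf.1.
move=> f bf f0; rewrite -Hm// /mean /itvint /Rintegral; congr fine.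
rewrite (ge0_integral_quantile H01)//; last by apply/measurable_EFinP; exact: bf.1.
have HF x : 0 <= x <= 1 -> cdf_of H x = x.
  move=> /andP[x0 x1]; rewrite /cdf_of HE; last exact: measurable_itv.
  rewrite (_ : _ `&` _ = `[0, x]); last first.
    rewrite eqEsubset; split => t /=; rewrite !in_itv /=.
      by move=> [tx /andP[t0 _]]; rewrite t0.
    by move=> /andP[t0 tx]; rewrite t0 tx (le_trans tx).
  by rewrite lebesgue_measure_itv /= lte_fin; case: ltP => /= h; lra.
apply: eq_integral => t; rewrite inE /= in_itv /= => /andP[t0 t1].
congr ((f _)%:E); rewrite /total_quantile; case: (leP t 0) => t0'; first by lra.
rewrite t1; have q01 := quantile_itv H01 t0' t1.
apply/eqP; rewrite eq_le quantile_le// HF ?t0 ?t1// lexx /=.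
by rewrite -[leRHS](HF _ q01) -quantile_le.
Qed.

Section LabelLaw.
Local Open Scope classical_set_scope.
Variables (G : probability R R) (M : probability (R * R)%type R).
Hypotheses (G01 : G `[0, 1] = 1%E)
  (GE : forall A, measurable A -> agg_labels w pi A = G A)
  (Mm : forall f, bounded_mfun f -> mean M f = \sum_(i < n) w i * mean (pi i) f)
  (M2 : forall f : R -> R, bounded_mfun f -> (forall x, 0 <= f x) ->
     mean M (fun z => f z.2) = itvint 0 1 (fun t => f (total_quantile G t)))
  (M1 : forall f : R -> R, bounded_mfun f -> (forall x, 0 <= f x) ->
     mean M (fun z => f z.1) = itvint 0 1 f).
Let V := desirability dens w pi.
Let x := total_quantile G.
Let ndx : nondecreasing_fun x := total_quantile_nondecreasing G01.
Let x01 t : 0 <= x t <= 1 := total_quantile_itv G01 t.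
Let lx : lbm x := lbm_nondecreasing ndx.
Let C := cdf_of G.
Let at_ y := fine (G [set y]).

Let label_cdfE y : label_cdf w pi y = C y.
Proof. by rewrite /label_cdf GE//; exact: measurable_itv. Qed.

Let label_atomE y : label_atom w pi y = at_ y.
Proof. by rewrite /label_atom GE. Qed.

Let job_quantile_total t : 0 <= t <= 1 -> job_quantile dens t = Q t.
Proof.
case/andP; rewrite le_eqVlt => /predU1P[<- _|t0 t1]; last first.
  by rewrite (job_quantileE jd t0) /Q /total_quantile leNgt t0 t1.
(* At rank 0 every nonnegative quality qualifies, so the infimum is 0, the value given to [Q 0]. *)
rewrite /Q /total_quantile lexx /job_quantile; apply/eqP; rewrite eq_le; apply/andP; split.
  apply: ge_inf; first by exists 0 => q [].
  by split => //; rewrite (job_cdfE jd); case/andP: (cdf_of_itv J 0).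
apply: lb_le_inf; last by move=> q [].
exists 0; split => //; rewrite (job_cdfE jd); by case/andP: (cdf_of_itv J 0).
Qed.

Let C01 y : 0 <= C y <= 1 := cdf_of_itv G y.

Let at_ge0 y : 0 <= at_ y. Proof. by rewrite fine_ge0. Qed.

Let at_jump y z : y < z -> C y + at_ z <= C z.
Proof.
move=> yz; rewrite -lee_fin EFinD !cdf_ofE /at_ fineK ?fin_num_measure//.
have mI : measurable (`]-oo, y] : set R) by exact: measurable_itv.
have disj : `]-oo, y] `&` [set z] = set0.
  rewrite -subset0 => t /= []; rewrite in_itv /= => ty tz.
  by move: ty; rewrite tz leNgt yz.
have <- : G (`]-oo, y] `|` [set z]) = (G `]-oo, y] + G [set z])%E by exact: measureU.
apply: le_measure; rewrite ?inE.
- by apply: measurableU => //; exact: measurable_itv.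
- exact: measurable_itv.
move=> t /= []; rewrite !in_itv /=; first by move=> /le_lt_trans /(_ yz) /ltW.
by move=> ->.
Qed.

Let at_le y : at_ y <= C y.
Proof.
rewrite -lee_fin cdf_ofE /at_ fineK ?fin_num_measure//.
by apply: le_measure; rewrite ?inE// => t /= ->; rewrite in_itv /=.
Qed.

Let VE y : V y = if 0 < at_ y then itvint (C y - at_ y) (C y) Q / at_ y else Q (C y).
Proof.
rewrite /V /desirability label_cdfE label_atomE.
have /andP[c0 c1] := C01 y; have a1 := at_le y.
case: ifPn => ap; last by rewrite job_quantile_total ?c0.
congr (_ / _); apply: eq_itvint => t /andP[t0 t1].
by rewrite job_quantile_total// (le_trans t1 c1) andbT; lra.
Qed.

Let V_bounds y : Q (C y - at_ y) <= V y <= Q (C y).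
Proof.
rewrite VE; case: ifPn => ap; last first.
  by rewrite lexx andbT; apply: ndQ; have := at_ge0 y; lra.
have cc : C y - at_ y <= C y by lra.
have E : C y - (C y - at_ y) = at_ y by ring.
apply/andP; split; [rewrite ler_pdivlMr//|rewrite ler_pdivrMr//].
  rewrite -[X in _ * X]E -itvint_cst//; apply: itvint_le => //; first exact: lbm_cst.
  by move=> t /andP[/ltW /ndQ].
rewrite -[X in _ * X]E -itvint_cst//; apply: itvint_le => //; first exact: lbm_cst.
by move=> t /andP[_ /ltW /ndQ].
Qed.

(** A larger label occupies ranks lying entirely after those of a smaller one, and [V] lies between
    the extreme qualities of its ranks. *)
Let ndV : nondecreasing_fun V.
Proof.
move=> y z; rewrite le_eqVlt => /predU1P[->//|yz].
have /andP[_ h1] := V_bounds y; have /andP[h2 _] := V_bounds z.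
apply: le_trans h1 (le_trans _ h2); apply: ndQ.
have := at_jump yz; lra.
Qed.

Let V0 y : 0 <= V y.
Proof.
by have /andP[h _] := V_bounds y; apply: le_trans h; case/andP: (Q01 (C y - at_ y)).
Qed.

Let bV : bounded_mfun V.
Proof.
split; first exact: nondecreasing_measurable.
exists 1 => y; rewrite ger0_norm//.
by have /andP[_ h] := V_bounds y; apply: le_trans h _; case/andP: (Q01 (C y)).
Qed.

Let best i (pi' : probability (R * R)%type R) : is_transcript (F i) pi' ->
  mean pi' (fun z => V z.2) <= mean (pi i) (fun z => V z.2).
Proof.
move=> tr'; rewrite -lee_fin !meanE; [exact: eqm.2 tr'| |]; exact: (bm_comp m2 bV).
Qed.

(** Strictness holds because job qualities have no atom: [job_cdf] is a left inverse of [Q]. *)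
Let Q_inj_lt s t : 0 <= s -> s < t -> t <= 1 -> Q s < Q t.
Proof.
move=> s0 st t1; rewrite lt_neqAle ndQ ?(ltW st)// andbT.
apply/eqP => E; have t0 := le_trans s0 (ltW st); have s1 := le_trans (ltW st) t1.
have := job_cdf_quantile jd (t := s); rewrite -/J -/Q E job_cdf_quantile ?t0 ?t1//.
by rewrite s0 s1 => /(_ isT); lra.
Qed.

Let no_atom y : G [set y] = 0%E.
Proof.
have [y01|y01] := boolP (0 <= y <= 1); last first.
  apply/eqP; rewrite eq_le measure_ge0 andbT.
  have <- : G (~` `[0, 1]) = 0%E.
    by apply: (eq_trans (probability_setC G (measurable_itv _))); rewrite G01 subee.
  apply: le_measure; rewrite ?inE//.
    by apply: measurableC; exact: measurable_itv.
  by move=> t /= ->; rewrite in_itv; exact/negP.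
have [a0|ap] := leP (at_ y) 0.
  have : at_ y = 0 by have := at_ge0 y; lra.
  by rewrite /at_ => E; rewrite -[LHS]fineK ?fin_num_measure// E.
exfalso.
have /andP[c0 c1] := C01 y; have ale := at_le y.
(* [V y] averages [Q] over the ranks of the atom. On their lower half [Q] is at most
   [Q half < Q (C y)], whereas every larger label earns at least [Q (C y)]; so one ratio [r < 1]
   serves all larger labels. *)
pose half := C y - at_ y / 2.
have Qh : Q half < Q (C y) by apply: Q_inj_lt => //; rewrite /half; lra.
have Qh0 : 0 <= Q half by case/andP: (Q01 half).
have Vlt : V y <= (Q half + Q (C y)) / 2.
  rewrite VE ap ler_pdivrMr//.
  have h1 : C y - at_ y <= half by rewrite /half; lra.
  have h2 : half <= C y by rewrite /half; lra.
  rewrite (itvint_split lQ h1 h2).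
  have i1 : itvint (C y - at_ y) half Q <= Q half * (half - (C y - at_ y)).
    rewrite -itvint_cst//; apply: itvint_le => //; first exact: lbm_cst.
    by move=> t /andP[_ /ltW /ndQ].
  have i2 : itvint half (C y) Q <= Q (C y) * (C y - half).
    rewrite -itvint_cst//; apply: itvint_le => //; first exact: lbm_cst.
    by move=> t /andP[_ /ltW /ndQ].
  rewrite /half in i1 i2 *; lra.
have Qc : 0 < Q (C y) by exact: le_lt_trans Qh.
pose r := V y / Q (C y).
have r0 : 0 <= r by rewrite divr_ge0// ltW.
have r1 : r < 1 by rewrite ltr_pdivrMr// mul1r; lra.
have jump y' : y < y' <= 1 -> 0 < V y' /\ V y <= r * V y'.
  move=> /andP[yy' _].
  have QV : Q (C y) <= V y'.
    have /andP[h _] := V_bounds y'; apply: le_trans h; apply: ndQ.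
    by have := at_jump yy'; lra.
  split; first exact: lt_le_trans QV.
  by rewrite -[leLHS](divfK (lt0r_neq0 Qc)) -/r; apply: ler_wpM2l.
have z i : pi i (setT `*` [set y]) = 0%E.
  apply: (@no_label_atom _ (F i) (pi i) V (F01 i) (tr i) bV V0 (@best i) y r (2 / w i)) => //.
  - by rewrite r0.
  - by rewrite divr_ge0// ltW.
  - by move=> e e0; exact: F_dens.
move: ap; rewrite /at_ -GE// /agg_labels big1 ?ltxx//.
by move=> i _; rewrite z mule0.
Qed.

Let V_label y : V y = Q (C y).
Proof. by rewrite VE /at_ no_atom /= ltxx. Qed.

Let C_quantile t : 0 < t -> t <= 1 -> C (x t) = t.
Proof.
move=> t0 t1; rewrite /x /total_quantile leNgt t0 /= t1.
by apply: cdf_of_quantile => //; exact: no_atom.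
Qed.

Let x_le t y : 0 < t -> t <= 1 -> (x t <= y) = (t <= C y).
Proof.
by move=> t0 t1; rewrite /x /total_quantile [t <= 0]leNgt t0 /= t1 quantile_le.
Qed.

(** Calibration over all labels equates the mean label with the mean of the uniform abilities. *)
Lemma mean_label : itvint 0 1 x = 2^-1.
Proof.
have c0 a : 0 <= clamp a by case/andP: (clamp_itv a).
rewrite -(@eq_itvint _ _ _ (fun t => clamp (x t))); last by move=> t _; rewrite clamp_id.
rewrite -M2//.
have := mean_aggregate Mm (@measurableT _ R).
rewrite (_ : (fun z : R * R => \1_setT z.2 * clamp z.1) = (fun z => clamp z.1)); last first.
  by apply/funext => z; rewrite indicT mul1r.
rewrite (_ : (fun z : R * R => \1_setT z.2 * clamp z.2) = (fun z => clamp z.2)); last first.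
  by apply/funext => z; rewrite indicT mul1r.
move=> <-; rewrite M1// (@eq_itvint _ _ _ _ id); last by move=> t t01; rewrite clamp_id.
by rewrite itvint_id//; lra.
Qed.

(** Every school is tested with the same [y = x s] and [B] the labels up to [y]. The inequality is
    linear in the transcript law, so the weighted sum over types holds for [M]. *)
Lemma pooling_rank s : 0 < s < 1 ->
  Q s * ((1 - x s ^+ 2) / 2 - itvint s 1 x) <= x s * itvint 0 s Q.
Proof.
move=> /andP[s0 s1]; have s0' := ltW s0; have s1' := ltW s1.
pose y := x s; have y01 : 0 <= y <= 1 := x01 s.
have Cy : C y = s by exact: C_quantile.
pose B : set R := `]-oo, y]; have mB : measurable B by exact: measurable_itv.
pose up : set R := `]y, +oo[; have mup : measurable up by exact: measurable_itv.
have mCB : measurable (~` B) by exact: measurableC.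
have bB := bm_ind m2 mB; have bCB := bm_ind m2 mCB; have bu := bm_ind m1 mup.
have c1 := bm_clamp m1; have c2 := bm_clamp m2; have bV2 := bm_comp m2 bV.
have agg : V y * mean M (fun z => \1_B z.2 * (\1_up z.1 * clamp z.1))
    <= y * mean M (fun z => \1_B z.2 * V z.2).
  rewrite !Mm; try by bm_tac.
  rewrite !mulr_sumr; apply: ler_sum => i _.
  rewrite mulrCA [leRHS]mulrCA; apply: ler_wpM2l; first exact: ltW.
  apply: (pooling_le (F01 i) (tr i) bV V0 (@best i)) => //.
(* Without atoms, labels at most [x s] are exactly those at ranks at most [s], and the label at rank
   [t] earns [Q t]. *)
have rhs : mean M (fun z => \1_B z.2 * V z.2) = itvint 0 s Q.
  have bf : bounded_mfun (fun u : R => \1_B u * V u) by apply: bmM => //; exact: bm_indic.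
  rewrite (M2 bf); last by move=> u; rewrite mulr_ge0.
  have lf : lbm (fun t => (x t <= y)%R%:R * V (x t)).
    have l1 : lbm (fun t => (x t <= y)%R%:R : R).
      apply: lbm_nonincreasing => t u tu; case: (leP (x u) y) => xu; last by rewrite ler0n.
      by rewrite (le_trans (ndx tu) xu).
    have l2 : lbm (fun t => V (x t)).
      by apply: lbm_nondecreasing => t u tu; apply: ndV; exact: ndx.
    exact: lbmM.
  rewrite (@eq_itvint _ _ _ _ (fun t => (x t <= y)%R%:R * V (x t))); last first.
    by move=> t _; rewrite indicE /B mem_setE in_itv.
  rewrite (itvint_split lf s0' s1').
  have -> : itvint s 1 (fun t => (x t <= y)%R%:R * V (x t)) = 0.
    apply/eqP; rewrite eq_le; apply/andP; split; last first.
      by apply: itvint_ge0 => t _; rewrite mulr_ge0.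
    have <- : itvint s 1 (fun=> 0 : R) = 0 by rewrite itvint_cst// mul0r.
    apply: itvint_le => //; first exact: lbm_cst.
    move=> t /andP[st t1]; rewrite x_le ?Cy ?(ltW t1)// ?(lt_trans s0)//.
    by rewrite [t <= s]leNgt st mul0r.
  rewrite addr0; apply/eqP; rewrite eq_le; apply/andP; split; apply: itvint_le => //.
  - move=> t /andP[t0 ts]; have t1 := le_trans (ltW ts) s1'.
    by rewrite x_le// Cy (ltW ts) mul1r V_label C_quantile.
  - move=> t /andP[t0 ts]; have t1 := le_trans (ltW ts) s1'.
    by rewrite x_le// Cy (ltW ts) mul1r V_label C_quantile.
have h1 : mean M (fun z => \1_up z.1 * clamp z.1) = (1 - y ^+ 2) / 2.
  have bf : bounded_mfun (fun u : R => \1_up u * clamp u).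
    by apply: bmM; [exact: bm_indic|exact: bclamp].
  rewrite (M1 bf); last by move=> u; rewrite mulr_ge0//; case/andP: (clamp_itv u).
  case/andP: (y01) => y0 y1.
  have lf : lbm (fun t : R => (y < t)%R%:R * clamp t).
    apply: lbmM; last by apply: lbm_nondecreasing; exact: clamp_nondecreasing.
    by apply: lbm_upset => t u tu yt; exact: lt_le_trans tu.
  rewrite (@eq_itvint _ _ _ _ (fun t => (y < t)%R%:R * clamp t)); last first.
    by move=> t _; rewrite indicE /up mem_setE in_itv /= andbT.
  rewrite (itvint_split lf y0 y1) (@eq_itvint _ 0 y _ (fun=> 0)); last first.
    by move=> t /andP[_ ty]; rewrite ltNge ty mul0r.
  rewrite itvint_cst// mul0r add0r -[RHS](_ : itvint y 1 id = _); last first.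
    by rewrite itvint_id// expr1n.
  apply/eqP; rewrite eq_le; apply/andP; split; apply: itvint_le => //; try exact: lbm_id.
  - by move=> t /andP[yt t1]; rewrite yt mul1r clamp_id// (ltW t1) (le_trans y0)// ltW.
  - by move=> t /andP[yt t1]; rewrite yt mul1r clamp_id// (ltW t1) (le_trans y0)// ltW.
have h2 : mean M (fun z => \1_(~` B) z.2 * clamp z.1) = itvint s 1 x.
  rewrite (mean_aggregate Mm mCB).
  have bf : bounded_mfun (fun u : R => \1_(~` B) u * clamp u).
    by apply: bmM; [exact: bm_indic|exact: bclamp].
  rewrite (M2 bf); last by move=> u; rewrite mulr_ge0//; case/andP: (clamp_itv u).
  have lf : lbm (fun t => (y < x t)%R%:R * x t).
    apply: lbmM => //.
    by apply: lbm_upset => t u tu yt; apply: lt_le_trans (ndx tu).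
  rewrite (@eq_itvint _ _ _ _ (fun t => (y < x t)%R%:R * x t)); last first.
    by move=> t _; rewrite indicE /B in_setC mem_setE in_itv /= -ltNge clamp_id.
  rewrite (itvint_split lf s0' s1').
  have -> : itvint 0 s (fun t => (y < x t)%R%:R * x t) = 0.
    rewrite (@eq_itvint _ _ _ _ (fun=> 0)); first by rewrite itvint_cst// mul0r.
    by move=> t /andP[_ /ndx]; rewrite -/y ltNge => ->; rewrite mul0r.
  rewrite add0r; apply/eqP; rewrite eq_le; apply/andP; split; apply: itvint_le => //.
  - move=> t /andP[st t1]; have -> : y < x t by rewrite ltNge x_le ?(ltW t1)// ?(lt_trans s0)// Cy -ltNge.
    by rewrite mul1r.
  - move=> t /andP[st t1]; have -> : y < x t by rewrite ltNge x_le ?(ltW t1)// ?(lt_trans s0)// Cy -ltNge.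
    by rewrite mul1r.
have lower : (1 - y ^+ 2) / 2 - itvint s 1 x
    <= mean M (fun z => \1_B z.2 * (\1_up z.1 * clamp z.1)).
  rewrite -h1 -h2 -meanB; try by bm_tac.
  apply: mean_le; [by bm_tac|by bm_tac|move=> z].
  have /andP[k0 _] := clamp_itv z.1.
  rewrite !indicE in_setC; case: (z.2 \in B); case: (z.1 \in up) => /=;
  by rewrite ?mul0r ?mul1r ?subr0 ?subrr ?sub0r ?oppr_le0.
rewrite rhs V_label Cy in agg; apply: le_trans agg.
by apply: ler_wpM2l => //; case/andP: (Q01 s).
Qed.

Let eq_label_total q : eq_label dens w pi q = x (job_cdf dens q).
Proof.
rewrite /eq_label /x /total_quantile.
have /andP[j0 j1] : 0 <= job_cdf dens q <= 1 by rewrite (job_cdfE jd); exact: cdf_of_itv.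
(* At level 0 the defining set is the whole line; its infimum takes the default value 0, which is
   also [total_quantile] there. *)
case: (leP _ 0) => jle.
  apply: inf_out => -[_ [l hl]]; have := hl (l - 1).
  have j00 : job_cdf dens q = 0 by lra.
  rewrite /= label_cdfE j00; have /andP[h _] := C01 (l - 1); move=> /(_ h); lra.
rewrite j1 /quantile_of; congr inf.
by rewrite eqEsubset; split => z /=; rewrite label_cdfE.
Qed.

(** Substituting [q = Q t] turns [job_cdf dens q] into the rank [t], so both outputs become
    integrals over ranks. *)
Lemma output_le : total_output dens (truthful_label dens)
  <= 136 / 100 * total_output dens (eq_label dens w pi) /\
  0 <= total_output dens (eq_label dens w pi).
Proof.
have nj : nondecreasing_fun (job_cdf dens).
  by move=> s t st; rewrite !(job_cdfE jd); exact: cdf_of_nondecreasing.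
have j0 q : 0 <= job_cdf dens q by rewrite (job_cdfE jd); case/andP: (cdf_of_itv J q).
have E1 : total_output dens (truthful_label dens) = itvint 0 1 (fun t => t * Q t).
  rewrite (total_outputE jd)//; apply: eq_itvint => t t01.
  by rewrite /truthful_label job_cdf_quantile// mulrC.
have E2 : total_output dens (eq_label dens w pi) = itvint 0 1 (fun t => x t * Q t).
  have -> : eq_label dens w pi = (fun q => x (job_cdf dens q)).
    by apply/funext => q; exact: eq_label_total.
  rewrite (total_outputE jd).
  - by apply: eq_itvint => t t01; rewrite job_cdf_quantile// mulrC.
  - by move=> s t st; apply: ndx; exact: nj.
  - by move=> q; case/andP: (x01 (job_cdf dens q)).
rewrite E1 E2; split.
  exact: (rank_output_le_136 ndx x01 ndQ Q01 mean_label pooling_rank).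
apply: itvint_ge0 => t _; apply: mulr_ge0.
  by case/andP: (x01 t).
by case/andP: (Q01 t).
Qed.

End LabelLaw.

Lemma price_of_anarchy_le :
  total_output dens (truthful_label dens) / total_output dens (eq_label dens w pi)
    <= 136 / 100.
Proof.
have [G G01 [GE [M [Mm M2 M1]]]] := label_law_exists.
have [le_out] := output_le G01 GE Mm M2 M1.
(* For a zero denominator the quotient is 0 by convention. *)
rewrite le_eqVlt => /predU1P[<-|out0]; first by rewrite invr0 mulr0; lra.
by rewrite ler_pdivrMr.
Qed.

End Equilibrium.

Unset Implicit Arguments. Set Strict Implicit. Set Printing Implicit Defensive.

Theorem mainTheorem6 (R : realType) (dens : R -> R) (n : nat) (w : 'I_n -> R)
    (F : 'I_n -> probability R R)
    (pi : 'I_n -> probability (R * R)%type R) :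
  is_job_density dens ->
  finitely_many_switches (truthful_map dens) ->
  school_types w F ->
  is_equilibrium dens w F pi ->
  is_connected w pi ->
  total_output dens (truthful_label dens) / total_output dens (eq_label dens w pi)
    <= 136 / 100.
Proof. by move=> jd _ sch eqm _; exact: price_of_anarchy_le jd sch eqm. Qed.
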